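(* Let $K$ be a finite field of characteristic $p$, $G$ a finite group and $B$ a $p$-block of $KG$ (viewed as an algebra with identity its block idempotent). The following are equivalent: (a) every right ideal of $B$ is checkable in $B$; (b) every left ideal of $B$ is principal; (c) up to isomorphism, $B$ has exactly one irreducible left module $M$, and the projective cover $P(M)$ of $M$ is uniserial.
   Context: Write $KG=B_0\oplus\cdots\oplus B_s$ as the decomposition into $p$-blocks, $B_i=f_iKG$ with $f_i$ the primitive central idempotents (block idempotents); each $B_i$ is a two-sided ideal and an algebra with identity $f_i$. A right ideal $I$ of $B$ is checkable in $B$ if there is $v\in B$ with $I=\{b\in B: vb=0\}$. A module is uniserial if it has exactly one composition series. The projective cover $P(M)$ of an irreducible module $M$ is the indecomposable projective module having a quotient isomorphic to $M$. *)

(* Defs.v *)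
From HB Require Import structures.
From mathcomp Require Import all_boot all_order all_algebra all_fingroup.
From mathcomp Require Import all_field mxrepresentation.
Set Implicit Arguments. Unset Strict Implicit. Unset Printing Implicit Defensive.
Import GRing.Theory.
Local Open Scope ring_scope.

(* Elements of KG = sum_g a(g) g are encoded as finite functions gT -> K;     *)
(* the finite group G is the whole finGroupType gT.  Addition is the          *)
(* pointwise (zmodType) structure on {ffun gT -> K}.                           *)

Definition gmul (K : fieldType) (gT : finGroupType) (a b : {ffun gT -> K})
  : {ffun gT -> K} :=
  [ffun x => \sum_(y : gT) a y * b (y^-1 * x)%g].

Definition gcentral (K : fieldType) (gT : finGroupType) (e : {ffun gT -> K}) :=
  forall a : {ffun gT -> K}, gmul e a = gmul a e.

Definition gcentral_idem (K : fieldType) (gT : finGroupType) (e : {ffun gT -> K}) :=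
  gcentral e /\ gmul e e = e.

Definition block_idem (K : fieldType) (gT : finGroupType) (f : {ffun gT -> K}) :=
  [/\ gcentral_idem f, f != 0 &
      forall e1 e2 : {ffun gT -> K}, gcentral_idem e1 -> gcentral_idem e2 ->
        f = e1 + e2 -> gmul e1 e2 = 0 -> e1 = 0 \/ e2 = 0].

Definition inBlock (K : fieldType) (gT : finGroupType) (f b : {ffun gT -> K}) :=
  exists a : {ffun gT -> K}, b = gmul f a.

Definition addsubgroup_in (K : fieldType) (gT : finGroupType) (f : {ffun gT -> K})
    (I : {ffun gT -> K} -> Prop) :=
  [/\ forall x, I x -> inBlock f x, I 0 & forall x y, I x -> I y -> I (x - y)].

Definition right_ideal (K : fieldType) (gT : finGroupType) (f : {ffun gT -> K})
    (I : {ffun gT -> K} -> Prop) :=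
  addsubgroup_in f I /\ forall x b, I x -> inBlock f b -> I (gmul x b).

Definition left_ideal (K : fieldType) (gT : finGroupType) (f : {ffun gT -> K})
    (I : {ffun gT -> K} -> Prop) :=
  addsubgroup_in f I /\ forall x b, I x -> inBlock f b -> I (gmul b x).

Definition checkable (K : fieldType) (gT : finGroupType) (f : {ffun gT -> K})
    (I : {ffun gT -> K} -> Prop) :=
  exists2 v, inBlock f v &
    forall b, I b <-> (inBlock f b /\ gmul v b = 0).

Definition principal_left (K : fieldType) (gT : finGroupType) (f : {ffun gT -> K})
    (I : {ffun gT -> K} -> Prop) :=
  exists2 a, inBlock f a &
    forall x, I x <-> exists2 b, inBlock f b & x = gmul b a.

(* A finite-dimensional left KG-module of dimension n is encoded by a          *)
(* representation rG : mx_representation K [set: gT] n, the element g acting   *)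
(* on row vectors by v |-> v *m rG (g^-1).  Hence a in KG acts by the matrix   *)
(* gact rG a (v |-> v *m gact rG a), and (a b).v = a.(b.v).                    *)
Definition gact (K : fieldType) (gT : finGroupType) n
    (rG : mx_representation K [set: gT] n) (a : {ffun gT -> K}) : 'M[K]_n :=
  \sum_(g : gT) a g *: rG (g^-1)%g.

Definition Bmodule (K : fieldType) (gT : finGroupType) (f : {ffun gT -> K}) n
    (rG : mx_representation K [set: gT] n) :=
  gact rG f = 1%:M.

Definition modhom (K : fieldType) (gT : finGroupType) n1 n2
    (r1 : mx_representation K [set: gT] n1) (r2 : mx_representation K [set: gT] n2)
    (h : 'M[K]_(n1, n2)) :=
  forall g : gT, r1 g *m h = h *m r2 g.

Definition Bprojective (K : fieldType) (gT : finGroupType) (f : {ffun gT -> K}) n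
    (rP : mx_representation K [set: gT] n) :=
  forall m1 m2 (r1 : mx_representation K [set: gT] m1)
         (r2 : mx_representation K [set: gT] m2)
         (pi : 'M[K]_(m1, m2)) (phi : 'M[K]_(n, m2)),
    Bmodule f r1 -> Bmodule f r2 ->
    modhom r1 r2 pi -> row_full pi -> modhom rP r2 phi ->
    exists psi : 'M[K]_(n, m1), modhom rP r1 psi /\ psi *m pi = phi.

Definition indecomposable (K : fieldType) (gT : finGroupType) n
    (rP : mx_representation K [set: gT] n) :=
  (0 < n)%N /\
  forall U V : 'M[K]_n, mxmodule rP U -> mxmodule rP V ->
    mxdirect (U + V) -> (U + V == 1%:M)%MS -> (U == 0) || (V == 0).

Definition proj_cover (K : fieldType) (gT : finGroupType) (f : {ffun gT -> K})
    n (rP : mx_representation K [set: gT] n)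
    m (rM : mx_representation K [set: gT] m) :=
  [/\ Bmodule f rP, Bprojective f rP, indecomposable rP &
      exists2 h : 'M[K]_(n, m), modhom rP rM h & row_full h].

Definition comp_series (K : fieldType) (gT : finGroupType) n
    (rP : mx_representation K [set: gT] n) (Us : seq 'M[K]_n) :=
  mx_composition_series rP Us /\ (last 0 Us == 1%:M)%MS.

Definition uniserial (K : fieldType) (gT : finGroupType) n
    (rP : mx_representation K [set: gT] n) :=
  (exists Us, comp_series rP Us) /\
  forall Us Vs, comp_series rP Us -> comp_series rP Vs ->
    size Us = size Vs /\ forall i, (nth 0 Us i == nth 0 Vs i)%MS.

(* Main.v *)
Require Import Defs.
From HB Require Import structures.
From mathcomp Require Import all_boot all_order all_algebra all_fingroup.
From mathcomp Require Import all_field mxrepresentation.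
From mathcomp Require Import boolp zify.
Set Implicit Arguments. Unset Strict Implicit. Unset Printing Implicit Defensive.
Import GRing.Theory.
Local Open Scope ring_scope.

(** Let [M] be a simple [B]-module and [J] its annihilator.
    The form [(a, b) |-> (a * b) 1] on [KG] is symmetric and nondegenerate, so
    left and right annihilators of ideals are inverse to each other: this gives
    (a) <-> (b).

    (b) -> (c): [J = Bx]. Some power [e = x ^+ k] is idempotent, because [KG] is
    finite, and [Be] is two-sided; symmetry makes [e] central, so [e = 0] since
    [f] is a block idempotent and [x] kills [M]. Hence [J] is nilpotent, it kills
    every simple module, and [M] is the only one. Left and right multiplication
    by [x] have the same rank, so [J = xB] and [JP = xP] for every module [P]. If
    [P] is projective indecomposable with top [M], then [P / xP] has dimension
    [dim M], hence so has every nonzero [x^k P / x^(k+1) P], and the [x^k P] are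
    all the submodules.

    (c) -> (b): with a single simple module Nakayama's lemma holds for [J]. For an
    idempotent [e], [dim (Je / J^2 e) <= dim (Be / Je)]: this reduces to [e]
    primitive, where [Be] is uniserial. Taking [e = f], the ideal [J] is generated
    by as many elements as [B], so [J = Bx = xB]. Then [dim (V / xV)], which is the
    dimension of the kernel of [x] on a left ideal [V], is at most [dim (B / xB)],
    and so [V] is principal. *)

(* [all_fingroup] shadows [Defs.gact] by the notion of group action. *)
Local Notation gact := Defs.gact.

(** An alias, so that convolution rather than a pointwise product becomes the ring
    multiplication. *)
Definition kG (K : finFieldType) (gT : finGroupType) := {ffun gT -> K}.

(** * The group algebra as a ring, and its symmetric form *)

Section GroupAlgebra.
Variables (K : finFieldType) (gT : finGroupType).
Local Notation A := (kG K gT).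

HB.instance Definition _ := Finite.on A.
HB.instance Definition _ := GRing.Zmodule.on A.

Definition gone : A := [ffun g => (g == 1%g)%:R].

Lemma gmulA : associative (@gmul K gT : A -> A -> A).
Proof.
move=> a b c; apply/ffunP=> x; rewrite !ffunE.
under eq_bigr do rewrite ffunE big_distrr /=.
under [RHS]eq_bigr do rewrite ffunE big_distrl /=.
rewrite [RHS]exchange_big; apply: eq_bigr => y _ /=.
rewrite (reindex_inj (mulgI y^-1%g)); apply: eq_bigr => z _ /=.
by rewrite invMg invgK mulrA -!mulgA mulKVg.
Qed.

Lemma gmul1l : left_id gone (@gmul K gT : A -> A -> A).
Proof.
move=> a; apply/ffunP=> x; rewrite ffunE (bigD1 1%g) //= ffunE eqxx mul1r.
rewrite invg1 mul1g big1 ?addr0 // => y /negbTE ne.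
by rewrite ffunE ne mul0r.
Qed.

Lemma gmul1r : right_id gone (@gmul K gT : A -> A -> A).
Proof.
move=> a; apply/ffunP=> x; rewrite ffunE (bigD1 x) //= ffunE mulVg eqxx mulr1.
rewrite big1 ?addr0 // => y ne; rewrite ffunE -eq_mulVg1 (negbTE ne) mulr0 //.
Qed.

Lemma gmulDl : left_distributive (@gmul K gT : A -> A -> A) +%R.
Proof.
move=> a b c; apply/ffunP=> x; rewrite !ffunE -big_split /=.
by apply: eq_bigr => y _; rewrite !ffunE mulrDl.
Qed.

Lemma gmulDr : right_distributive (@gmul K gT : A -> A -> A) +%R.
Proof.
move=> a b c; apply/ffunP=> x; rewrite !ffunE -big_split /=.
by apply: eq_bigr => y _; rewrite !ffunE mulrDr.
Qed.

HB.instance Definition _ := GRing.Zmodule_isPzRing.Build A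
  gmulA gmul1l gmul1r gmulDl gmulDr.

Lemma gmulE (a b : A) : gmul a b = a * b. Proof. by []. Qed.

Definition gdelta (g : gT) : A := [ffun x => (x == g)%:R].

Lemma gdelta_mulE g (a : A) x : (gdelta g * a) x = a (g^-1 * x)%g.
Proof.
rewrite ffunE (bigD1 g) //= ffunE eqxx mul1r big1 ?addr0 // => y /negbTE ne.
by rewrite ffunE ne mul0r.
Qed.

Lemma gmul_deltaE g (a : A) x : (a * gdelta g) x = a (x * g^-1)%g.
Proof.
rewrite ffunE (bigD1 (x * g^-1)%g) //= ffunE invMg invgK mulgKV eqxx mulr1.
rewrite big1 ?addr0 // => y ne; rewrite ffunE [_ == g]negbTE ?mulr0 //.
by apply: contraNneq ne => <-; rewrite invMg invgK mulKVg.
Qed.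

Lemma mul_at1C (a b : A) : (a * b) 1%g = (b * a) 1%g.
Proof.
rewrite !ffunE (reindex_inj invg_inj) /=; apply: eq_bigr => y _.
by rewrite !mulg1 invgK mulrC.
Qed.

(** Nondegeneracy of the symmetric form: pairing with [gdelta g^-1] reads off the coefficient at
    [g]. *)
Lemma at1_eq0 (a : A) : (forall b : A, (a * b) 1%g = 0) -> a = 0.
Proof.
move=> h; apply/ffunP=> g; have := h (gdelta g^-1%g).
by rewrite gmul_deltaE invgK mul1g => ->; rewrite ffunE.
Qed.

(** By pigeonhole the powers of [x] are eventually periodic. Finiteness enters through an injection
    into a finite type, so that the lemma serves both [KG] and matrices. *)
Lemma idem_power (R : pzSemiRingType) (T : finType) (i : R -> T) (x : R) :
  injective i -> exists2 k, (0 < k)%N & x ^+ k * x ^+ k = x ^+ k.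
Proof.
move=> i_inj; pose F (n : 'I_(#|T|.+1)) := i (x ^+ n.+1).
have [injF|] := boolP (injectiveb F).
  have := leq_card F (injectiveP _ injF); by rewrite card_ord ltnn.
case/injectivePn=> m [n ne /i_inj eqx].
wlog lt_mn : m n ne eqx / (m < n)%N => [W|].
  case: (ltngtP m n) => [|lt|/val_inj e]; [exact: W| |by rewrite e eqxx in ne].
  by apply: (W n m) => //; rewrite eq_sym.
have [p ep p0] : exists2 p, (n.+1 = m.+1 + p)%N & (0 < p)%N.
  by exists (n - m)%N; rewrite ?subn_gt0 // addSn subnKC // ltnW.
have per j : (m < j)%N -> forall q, x ^+ (j + q * p) = x ^+ j.
  move=> lt_mj; elim=> [|q IH]; first by rewrite mul0n addn0.
  rewrite mulSn addnCA exprD -[in RHS]IH.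
  rewrite -(subnKC lt_mj) -addnA !exprD !mulrA; congr (_ * _ * _).
  by rewrite -exprD addnC -ep eqx.
(* A multiple of the period that exceeds [m]: doubling it adds [m.+1] whole periods. *)
exists (m.+1 * p)%N; first by rewrite muln_gt0.
by rewrite -exprD per // leq_pmulr.
Qed.

(** * The action of the group algebra on a module *)

Section Action.
Variables (n : nat) (r : mx_representation K [set: gT] n).
Implicit Types a b : A.
Local Notation act a := (gact r a).

Lemma gactD a b : act (a + b) = act a + act b.
Proof.
by rewrite -big_split; apply: eq_bigr => g _; rewrite ffunE scalerDl.
Qed.

Lemma gactN a : act (- a) = - act a.
Proof. by rewrite -sumrN; apply: eq_bigr => g _; rewrite ffunE scaleNr. Qed.

Lemma gactB a b : act (a - b) = act a - act b.
Proof. by rewrite gactD gactN. Qed.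

Lemma gact0 : act (0 : A) = 0.
Proof. by rewrite /gact big1 // => g _; rewrite ffunE scale0r. Qed.

Lemma gact_delta g : act (gdelta g) = r g^-1%g.
Proof.
rewrite /gact (bigD1 g) //= ffunE eqxx scale1r big1 ?addr0 // => y /negbTE ne.
by rewrite ffunE ne scale0r.
Qed.

Lemma gact1 : act (1 : A) = 1%:M.
Proof. by rewrite -[1]/(gdelta 1%g) gact_delta invg1 repr_mx1. Qed.

Lemma gactM a b : act (a * b) = act b *m act a.
Proof.
rewrite /gact mulmx_suml; transitivity
  (\sum_(g : gT) \sum_(h : gT) (a h * b (h^-1 * g)%g) *: r g^-1%g).
  by apply: eq_bigr => g _; rewrite ffunE scaler_suml.
rewrite exchange_big /=.
transitivity (\sum_(h : gT) \sum_(g : gT) (a h * b g) *: r (h * g)^-1%g).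
  apply: eq_bigr => h _; rewrite (reindex_inj (mulgI h)); apply: eq_bigr => g _.
  by rewrite mulKg.
rewrite exchange_big; apply: eq_bigr => g _ /=; rewrite mulmx_sumr.
apply: eq_bigr => h _; rewrite invMg repr_mxM ?inE // -scalemxAl -scalemxAr.
by rewrite scalerA mulrC.
Qed.

Lemma gactX a k : act (a ^+ k) = act a ^+ k.
Proof.
by elim: k => [|k IH]; rewrite ?expr0 ?gact1 // exprS exprSr gactM IH.
Qed.

Lemma mxmodule_gact m (U : 'M_(m, n)) :
  mxmodule r U <-> forall a, (U *m act a <= U)%MS.
Proof.
split=> [/mxmoduleP modU a | h].
  rewrite mulmx_sumr summx_sub // => g _; rewrite -scalemxAr scalemx_sub //.
  by rewrite modU // inE.
by apply/mxmoduleP=> g _; rewrite -[g]invgK -gact_delta.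
Qed.

(** In the coordinates [enc] this is the module map from [KG] sending [a] to [a.v]; its row space is
    the cyclic submodule generated by [v]. On the regular module it is a right multiplication. *)
Definition orb (v : 'rV[K]_n) : 'M[K]_(#|gT|, n) :=
  \matrix_i (v *m r (enum_val i)^-1%g).

End Action.

Implicit Types a b : A.

(** * Coordinates and the left regular module *)

Definition enc (a : A) : 'rV[K]_#|gT| := \row_i a (enum_val i).
Definition dec (v : 'rV[K]_#|gT|) : A := [ffun g => v 0 (enum_rank g)].

Lemma encK : cancel enc dec.
Proof. by move=> a; apply/ffunP=> g; rewrite ffunE mxE enum_rankK. Qed.

Lemma decK : cancel dec enc.
Proof. by move=> v; apply/rowP=> i; rewrite mxE ffunE enum_valK. Qed.

Lemma encD a b : enc (a + b) = enc a + enc b.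
Proof. by apply/rowP=> i; rewrite !mxE ffunE. Qed.
Lemma encN a : enc (- a) = - enc a.
Proof. by apply/rowP=> i; rewrite !mxE ffunE. Qed.
Lemma enc0 : enc 0 = 0.
Proof. by apply/rowP=> i; rewrite !mxE ffunE. Qed.
Lemma encB a b : enc (a - b) = enc a - enc b.
Proof. by rewrite encD encN. Qed.

Lemma enc_orb n (r : mx_representation K [set: gT] n) a v :
  enc a *m orb r v = v *m gact r a.
Proof.
rewrite mulmx_sum_row /gact mulmx_sumr.
rewrite [RHS](reindex_onto enum_val enum_rank) => [|g _]; last exact: enum_rankK.
apply: eq_big => [i|i _]; first by rewrite enum_valK eqxx.
by rewrite rowK mxE -scalemxAr.
Qed.

(** The matrix of [g] sends [v] to [x |-> v (g * x)], which is left multiplication by [g^-1]; the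
    inverse in [gact] then makes [a] act by left multiplication by [a]. *)
Definition lreg_mx (g : gT) : 'M[K]_#|gT| :=
  \matrix_(i, j) (enum_val i == g * enum_val j)%g%:R.

Lemma lreg_mxE (v : 'rV_#|gT|) g : v *m lreg_mx g = enc [ffun x => dec v (g * x)%g].
Proof.
apply/rowP=> j; rewrite !mxE ffunE.
rewrite (bigD1 (enum_rank (g * enum_val j)%g)) //= !mxE enum_rankK eqxx mulr1.
rewrite big1 ?addr0 ?ffunE // => i ne.
rewrite mxE [_ == _](_ : _ = false) ?mulr0 //.
by apply: contraNF ne => /eqP <-; rewrite enum_valK.
Qed.

Lemma lreg_repr : mx_repr [set: gT] lreg_mx.
Proof.
split=> [|g h _ _].
  apply/row_matrixP=> i; rewrite !rowE lreg_mxE mulmx1.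
  rewrite -[RHS]decK; congr enc; apply/ffunP=> x.
  by rewrite !ffunE mul1g.
apply/row_matrixP=> i; rewrite !rowE mulmxA !lreg_mxE encK.
congr enc; apply/ffunP=> x; rewrite !ffunE; congr (_ _ (enum_rank _)).
by rewrite mulgA.
Qed.
Definition lreg := MxRepresentation lreg_repr.

Lemma enc_lreg a b : enc b *m gact lreg a = enc (a * b).
Proof.
rewrite mulmx_sumr.
transitivity (\sum_(g : gT) a g *: enc (gdelta g * b)).
  apply: eq_bigr => g _; rewrite -scalemxAr; congr (_ *: _).
  rewrite [_ *m _]lreg_mxE encK; congr enc; apply/ffunP=> x.
  by rewrite gdelta_mulE ffunE.
apply/rowP=> j; rewrite summxE !mxE ffunE. apply: eq_bigr => g _.
by rewrite !mxE gdelta_mulE.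
Qed.

Lemma enc_rmul a b : enc a *m orb lreg (enc b) = enc (a * b).
Proof. by rewrite enc_orb enc_lreg. Qed.

Lemma orb_module n (r : mx_representation K [set: gT] n) v : mxmodule r (orb r v).
Proof.
apply/mxmodule_gact=> a; apply/row_subP=> i.
rewrite rowE -(decK (delta_mx _ _)) mulmxA enc_orb -mulmxA -gactM.
by rewrite -enc_orb submxMl.
Qed.

Lemma orb_sub n (r : mx_representation K [set: gT] n) v m (U : 'M_(m, n)) :
  (forall a, v *m gact r a <= U)%MS -> (orb r v <= U)%MS.
Proof.
by move=> h; apply/row_subP=> i; rewrite rowE -(decK (delta_mx _ _)) enc_orb.
Qed.

Lemma orbP n (r : mx_representation K [set: gT] n) v w :
  reflect (exists a, w = v *m gact r a) (w <= orb r v)%MS.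
Proof.
apply: (iffP submxP) => [[u ->]|[a ->]]; last by exists (enc a); rewrite enc_orb.
by exists (dec u); rewrite -enc_orb decK.
Qed.

(* Conjugating by inversion of the index set turns left into right translation. *)
Lemma rank_rmul (x : A) : \rank (orb lreg (enc x)) = \rank (gact lreg x).
Proof.
have inv_inj : injective (fun i : 'I_#|gT| => enum_rank (enum_val i)^-1%g).
  by move=> i j /enum_rank_inj /invg_inj /enum_val_inj.
pose s := perm inv_inj.
have sE i : enum_val (s i) = (enum_val i)^-1%g by rewrite permE enum_rankK.
have entry (M : 'M[K]_#|gT|) i j : M i j = (enc (gdelta (enum_val i)) *m M) 0 j.
  rewrite (_ : enc _ = delta_mx 0 i) -?rowE ?mxE //.
  by apply/rowP=> k; rewrite !mxE ffunE (inj_eq enum_val_inj).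
(* Both matrices have the entry [x (g_j * g_i^-1)] at position [(i, j)]. *)
have -> : gact lreg x = row_perm s (col_perm s (orb lreg (enc x))^T).
  apply/matrixP=> i j; transitivity (orb lreg (enc x) (s j) (s i)); last first.
    by rewrite [RHS]mxE [RHS]mxE [RHS]mxE.
  rewrite [LHS]entry enc_lreg [LHS]mxE gmul_deltaE [RHS]mxE sE invgK.
  by rewrite [_ *m _]lreg_mxE [RHS]mxE ffunE encK sE.
have perm_full t : row_full (perm_mx t : 'M[K]_#|gT|).
  by rewrite row_full_unit unitmx_perm.
rewrite row_permE col_permE eqmxMfull ?perm_full // mxrankMfree ?mxrank_tr //.
by rewrite row_free_unit unitmx_perm.
Qed.
End GroupAlgebra.

(** * Duality between left and right annihilators *)

Section Annihilators.
Variables (K : finFieldType) (gT : finGroupType).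
Local Notation A := (kG K gT).
Implicit Types (a b x y : A) (I : A -> Prop).

(** Ideals are given as additive subgroups only; multiplication by these central elements makes them
    subspaces. *)
Definition gscal (c : K) : A := [ffun g => if g == 1%g then c else 0].

Lemma enc_gscal c x : enc (gscal c * x) = c *: enc x.
Proof.
apply/rowP=> i; rewrite !mxE ffunE (bigD1 1%g) //= ffunE eqxx invg1 mul1g.
by rewrite big1 ?addr0 // => y /negbTE ne; rewrite ffunE ne mul0r.
Qed.

Lemma gscalC c x : gscal c * x = x * gscal c.
Proof.
apply/ffunP=> g; rewrite !ffunE (reindex_inj invg_inj) /=.
rewrite [RHS](reindex_inj (mulgI g)) /=; apply: eq_bigr => y _.
rewrite !ffunE invgK invMg mulgKV !(inv_eq invgK, invg1).
by case: eqP => [->|_]; rewrite ?mulg1 ?mul1g ?mul0r ?mulr0 // mulrC.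
Qed.

Definition subspace I :=
  [/\ I 0, forall x y, I x -> I y -> I (x - y) & forall c x, I x -> I (gscal c * x)].

Definition span_mx I : 'M[K]_#|gT| := (\sum_(a : A | `[<I a>]) <<enc a>>)%MS.

Lemma span_mxP I x : subspace I -> (enc x <= span_mx I)%MS <-> I x.
Proof.
case=> I0 IB IZ; split=> [|Ix]; last first.
  by rewrite (sumsmx_sup x) ?genmxE //; apply/asboolP.
have ID u v : I u -> I v -> I (u + v).
  by move=> Iu Iv; rewrite -[v]opprK; apply: (IB) => //; rewrite -sub0r; apply: (IB).
case/sub_sumsmxP=> u e.
have -> : x = \sum_(a : A | `[<I a>]) dec (u a *m <<enc a>>%MS).
  rewrite -[LHS]encK -[RHS]encK e; congr dec.
  elim/big_rec2: _ => [|a y1 y2 _ ->]; first by rewrite enc0.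
  by rewrite encD decK.
elim/big_ind: _ => // a /asboolP Ia.
have /submxP[w ew] : (u a *m <<enc a>> <= enc a)%MS by rewrite -(genmxE (enc a)) submxMl.
rewrite ew (mx11_scalar w) mul_scalar_mx -enc_gscal encK.
exact: IZ.
Qed.

(** A column of the cokernel matrix is a functional vanishing on [I] but not at [x], and the form
    represents every functional as [y |-> (y * c) 1]. *)
Lemma separation I x : subspace I -> ~ I x ->
  exists c : A, (forall y, I y -> (y * c) 1%g = 0) /\ (x * c) 1%g <> 0.
Proof.
move=> sI nIx; have : ~~ (enc x <= span_mx I)%MS by apply/negP=> /(span_mxP _ sI).
rewrite submxE => ne; pose C := cokermx (span_mx I).
have [j nej] : exists j, (enc x *m C) 0 j != 0.
  apply/existsP; apply: contraNT ne => /existsPn h; apply/eqP/rowP=> j.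
  by rewrite [RHS]mxE; apply/eqP; have := h j; rewrite negbK.
(* The inverse matches [(y * c) 1 = \sum_g y g * c g^-1]. *)
pose c : A := [ffun g => C (enum_rank g^-1%g) j].
have at1 y : (y * c) 1%g = (enc y *m C) 0 j.
  rewrite ffunE mxE (reindex_onto enum_val enum_rank) => [|g _]; last exact: enum_rankK.
  apply: eq_big => [i|i _]; first by rewrite enum_valK eqxx.
  by rewrite mulg1 [enc y 0 i]mxE ffunE invgK enum_valK.
exists c; split; last by rewrite at1; apply/eqP.
move=> y /(span_mxP _ sI); rewrite at1 submxE => /eqP; rewrite -/C => ->.
by rewrite mxE.
Qed.

Section BlockIdeals.
Variable f : A.
Hypothesis fC : forall a, f * a = a * f.
Hypothesis ff : f * f = f.

Lemma inBlockP x : inBlock f x <-> f * x = x.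
Proof. by split=> [[a ->]|e]; [rewrite gmulE mulrA ff | exists x]. Qed.

Lemma left_idealM I a x : left_ideal f I -> I x -> I (a * x).
Proof.
move=> [[IB _ _] IM] Ix; have /inBlockP fx := IB _ Ix.
have -> : a * x = gmul (f * a) x by rewrite gmulE -[in LHS]fx mulrA -fC.
by apply: IM => //; apply/inBlockP; rewrite mulrA ff.
Qed.

Lemma right_idealM I a x : right_ideal f I -> I x -> I (x * a).
Proof.
move=> [[IB _ _] IM] Ix; have /inBlockP fx := IB _ Ix.
have -> : x * a = gmul x (f * a) by rewrite gmulE mulrA -fC fx.
by apply: IM => //; apply/inBlockP; rewrite mulrA ff.
Qed.

Lemma left_ideal_subspace I : left_ideal f I -> subspace I.
Proof.
by move=> LI; have [[_ I0 IS] _] := LI; split=> // c x; apply: left_idealM.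
Qed.

Lemma right_ideal_subspace I : right_ideal f I -> subspace I.
Proof.
move=> LI; have [[_ I0 IS] _] := LI; split=> // c x.
by rewrite gscalC; apply: right_idealM.
Qed.

(** The left annihilator of [I] is some [Bv], and separation shows that [I] is in turn the right
    annihilator of [Bv], hence of [v]. *)
Lemma principal_checkable :
  (forall I, left_ideal f I -> principal_left f I) ->
  forall I, right_ideal f I -> checkable f I.
Proof.
move=> prin I RI; have [[IB I0 IS] _] := RI.
pose L a := f * a = a /\ forall x, I x -> a * x = 0.
have LI : left_ideal f L.
  split; first split.
  - by move=> x [] /inBlockP.
  - by split=> [|x _]; rewrite ?mulr0 ?mul0r.
  - move=> x y [fx hx] [fy hy]; split; first by rewrite mulrBr fx fy.
    by move=> z Iz; rewrite mulrBl hx // hy // subrr.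
  move=> x b [fx hx] /inBlockP fb; rewrite gmulE; split; first by rewrite mulrA fb.
  by move=> z Iz; rewrite -mulrA hx // mulr0.
have [v /inBlockP fv Lv] := prin L LI; exists v; first exact/inBlockP.
move=> b; split=> [Ib|[/inBlockP fb vb]].
  split; first exact: IB.
  have [_] : L v by apply/Lv; exists f; rewrite ?gmulE ?fv //; apply/inBlockP.
  exact.
apply: contrapT => nIb; have [c [cI cb]] := separation (right_ideal_subspace RI) nIb.
have /Lv [u _ e] : L (f * c).
  split=> [|y Iy]; first by rewrite mulrA ff.
  suff cy : c * y = 0 by rewrite -mulrA cy mulr0.
  (* By symmetry [(c * y * d) 1 = (y * d * c) 1], and [y * d] is still in [I]. *)
  apply: at1_eq0 => d; rewrite -mulrA mul_at1C; apply: cI; exact: right_idealM.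
apply: cb; rewrite mul_at1C -fb mulrA -fC e gmulE -mulrA.
by move: vb; rewrite gmulE => ->; rewrite mulr0 ffunE.
Qed.

(** By the choice of [v], the left ideals [L] and [Bv] have the same right annihilator, and
    separation recovers a left ideal from its right annihilator. *)
Lemma checkable_principal :
  (forall I, right_ideal f I -> checkable f I) ->
  forall I, left_ideal f I -> principal_left f I.
Proof.
move=> chk L LI; have [[LB L0 LS] _] := LI.
pose R b := f * b = b /\ forall x, L x -> x * b = 0.
have RI : right_ideal f R.
  split; first split.
  - by move=> x [] /inBlockP.
  - by split=> [|x _]; rewrite ?mulr0 ?mul0r.
  - move=> x y [fx hx] [fy hy]; split; first by rewrite mulrBr fx fy.
    by move=> z Iz; rewrite mulrBr hx // hy // subrr.
  move=> x b [fx hx] /inBlockP fb; rewrite gmulE; split; first by rewrite mulrA fx.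
  by move=> z Iz; rewrite mulrA hx // mul0r.
have [v [/inBlockP fv Rv]] : exists v : A, inBlock f v /\
    forall b : A, R b <-> inBlock f b /\ gmul v b = 0.
  by have [v] := chk R RI; exists v.
exists v; first exact/inBlockP.
have Rvc (c : A) : v * c = 0 -> R (f * c).
  move=> vc; apply/Rv; split; first by apply/inBlockP; rewrite mulrA ff.
  by rewrite gmulE mulrA -fC fv.
have Lv : L v.
  apply: contrapT => nLv.
  have [c [cL cv]] := separation (left_ideal_subspace LI) nLv; apply: cv.
  have /Rv [_] : R (f * c).
    split=> [|y Ly]; first by rewrite mulrA ff.
    have /inBlockP fy := LB _ Ly.
    rewrite mulrA -fC fy; apply: at1_eq0 => d; rewrite mul_at1C mulrA.
    by apply: cL; apply: left_idealM.
  by rewrite gmulE mulrA -fC fv => ->; rewrite ffunE.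
move=> x; split=> [Lx|[b fb ->]]; last exact: left_idealM.
pose I y := exists2 b, inBlock f b & y = gmul b v.
apply: contrapT => nIx.
have sI : subspace I.
  split.
  - exists 0; first by apply/inBlockP; rewrite mulr0.
    by rewrite gmulE mul0r.
  - move=> _ _ [b /inBlockP fb ->] [b' /inBlockP fb' ->]; exists (b - b').
      by apply/inBlockP; rewrite mulrBr fb fb'.
    by rewrite !gmulE mulrBl.
  move=> c _ [b /inBlockP fb ->]; exists (gscal c * b).
    by apply/inBlockP; rewrite mulrA fC -mulrA fb.
  by rewrite !gmulE mulrA.
have [c [cI cx]] := separation sI nIx; apply: cx.
have /Rvc [_ /(_ x Lx)] : v * c = 0.
  apply: at1_eq0 => d; rewrite mul_at1C mulrA.
  apply: cI; exists (f * d); first by apply/inBlockP; rewrite mulrA ff.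
  by rewrite gmulE fC -mulrA fv.
have /inBlockP fx := LB _ Lx.
by rewrite mulrA -fC fx => ->; rewrite ffunE.
Qed.

End BlockIdeals.
End Annihilators.

(** * Submodules and minimal left ideals *)

Section Modules.
Variables (K : finFieldType) (gT : finGroupType).
Local Notation A := (kG K gT).
Implicit Types a b c : A.

Lemma mxmodule_rV n (r : mx_representation K [set: gT] n) m (U : 'M_(m, n)) :
  mxmodule r U <-> forall a (v : 'rV_n), (v <= U -> v *m gact r a <= U)%MS.
Proof.
rewrite mxmodule_gact; split=> h a => [v vU|].
  exact: submx_trans (submxMr _ vU) (h a).
by apply/row_subP=> i; rewrite row_mul h ?row_sub.
Qed.

Lemma mxmodule_mulr n (r : mx_representation K [set: gT] n) m m' (U : 'M_(m, n))
  (V : 'M_(m', n)) a : mxmodule r U -> (V <= U -> V *m gact r a <= U)%MS.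
Proof. by move=> /mxmodule_gact h /submxMr/submx_trans; apply. Qed.

Lemma orb_mxmodule n (r : mx_representation K [set: gT] n) m (C : 'M_(m, #|gT|)) v :
  mxmodule (lreg K gT) C -> mxmodule r (C *m orb r v).
Proof.
move/mxmodule_rV=> modC; apply/mxmodule_rV=> a w /submxP[u ->].
rewrite mulmxA -(decK (u *m C)) enc_orb -mulmxA -gactM -enc_orb.
by rewrite submxMr // -enc_lreg modC // decK submxMl.
Qed.

(** The kernel is the left ideal of all [a] with [a.v] in [U]. *)
Lemma sub_orb_preim n (r : mx_representation K [set: gT] n) m (U : 'M_(m, n)) v
    m' (C : 'M_(m', #|gT|)) :
  (C <= kermx (orb r v *m cokermx U))%MS = (C *m orb r v <= U)%MS.
Proof. by rewrite sub_kermx mulmxA -submxE. Qed.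

Lemma orb_preim_module n (r : mx_representation K [set: gT] n) m (U : 'M_(m, n)) v :
  mxmodule r U -> mxmodule (lreg K gT) (kermx (orb r v *m cokermx U)).
Proof.
move=> modU; apply/mxmodule_rV=> a w; rewrite -(decK w) enc_lreg !sub_orb_preim.
rewrite !enc_orb gactM mulmxA; exact: mxmodule_mulr.
Qed.

Lemma irr_sub_full m (rM : mx_representation K [set: gT] m) m' (U : 'M_(m', m)) :
  mx_irreducible rM -> mxmodule rM U -> U != 0 -> row_full U.
Proof.
case/mx_irrP=> _ irr modU nzU; rewrite -sub1mx -(genmxE U) sub1mx.
apply: irr; first by rewrite (eqmx_module _ (genmxE U)).
by rewrite (eqmx_eq0 (genmxE U)).
Qed.

(* A minimal left ideal not sending [t] into [U] is, modulo the annihilator of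
   [t] modulo [U], a simple module; this replaces the semisimplicity of the
   algebra modulo the annihilator of [rM]. *)
Lemma minimal_left_ideal n (r : mx_representation K [set: gT] n)
    m (rM : mx_representation K [set: gT] m) (t : 'rV_n) (U : 'M_n) :
  mx_irreducible rM -> mxmodule r U -> ~~ (t <= U)%MS ->
  exists C : 'M_#|gT|, [/\ mxmodule (lreg K gT) C, ~~ (C *m orb r t <= U)%MS &
    forall c, (enc c <= C -> t *m gact r c <= U)%MS -> (enc c <= C)%MS -> gact rM c = 0].
Proof.
move=> irrM modU tU.
pose Q (C : 'M[K]_#|gT|) := mxmodule (lreg K gT) C && ~~ (C *m orb r t <= U)%MS.
have Q1 : Q 1%:M.
  rewrite /Q mxmodule1 mul1mx; apply: contra tU; apply: submx_trans.
  by apply/orbP; exists 1; rewrite gact1 mulmx1.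
case: (arg_minnP (fun C : 'M[K]_#|gT| => \rank C) Q1) => C /andP[modC CU] minC.
exists C; split=> // c ctU cC; have {}ctU := ctU cC.
apply/row_matrixP=> i; rewrite row0 rowE -enc_orb.
set s := delta_mx 0 i; set S := orb rM s; apply/eqP; apply: contraR CU => nz.
have modK0 : mxmodule (lreg K gT) (kermx S).
  have := orb_preim_module s (mxmodule0 rM m); rewrite -/S.
  rewrite (eqmx_module _ (_ : _ :=: kermx S)%MS) //.
  apply/eqmxP/rV_eqP=> w; rewrite sub_orb_preim submx0 sub_kermx //.
(* By minimality of [C]: the intersection is strictly smaller, since it omits [c]. *)
have DU : (C :&: kermx S <= kermx (orb r t *m cokermx U))%MS.
  rewrite sub_orb_preim; apply: contraT => DU.
  have := minC (C :&: kermx S)%MS; rewrite /Q capmx_module // DU => /(_ isT).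
  rewrite (geq_leqif (mxrank_leqif_sup (capmxSl _ _))) sub_capmx => /andP[_].
  by move/(submx_trans cC); rewrite sub_kermx (negbTE nz).
set C' := (C :&: kermx (orb r t *m cokermx U))%MS.
have cC' : (enc c <= C')%MS by rewrite sub_capmx cC sub_orb_preim enc_orb.
have full : row_full (C' *m S).
  apply: (irr_sub_full irrM).
    by apply: orb_mxmodule; apply: capmx_module; last exact: orb_preim_module.
  apply: contraNneq nz => e0; have := submxMr S cC'.
  by rewrite e0 => /submx0null ->.
(* As [C'.s] is all of [M], every element of [C] agrees on [s] with one of [C']; the difference
   kills [s], so it sends [t] into [U]. Hence [C.t] lies in [U], a contradiction. *)
have /submxP[w ew] := submx_full (C *m S) full.
have : (C - w *m C' <= kermx (orb r t *m cokermx U))%MS.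
  apply: submx_trans DU; rewrite sub_capmx addmx_sub ?eqmx_opp //=.
    by rewrite sub_kermx mulmxBl -mulmxA ew subrr.
  by rewrite mulmx_sub // capmxSl.
rewrite -sub_orb_preim => h; rewrite -[C](subrK (w *m C')) addmx_sub //.
by rewrite mulmx_sub // capmxSr.
Qed.

(** * The annihilator of a module and its products *)

Section Annihilator.
Variables (m : nat) (rM : mx_representation K [set: gT] m).

(** The product [JV], with [J] the annihilator of [rM]. *)
Definition annmul n (r : mx_representation K [set: gT] n) k (V : 'M_(k, n)) : 'M_n :=
  (\sum_(a : A | gact rM a == 0) <<V *m gact r a>>)%MS.

Section Annmul.
Variables (n : nat) (r : mx_representation K [set: gT] n).

Lemma annmul_subP k (V : 'M_(k, n)) k' (W : 'M_(k', n)) :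
  (annmul r V <= W)%MS <-> forall a, gact rM a = 0 -> (V *m gact r a <= W)%MS.
Proof.
split=> [h a a0 | h].
  apply: submx_trans h; rewrite (sumsmx_sup a) ?genmxE //; exact/eqP.
by apply/sumsmx_subP=> a /eqP a0; rewrite genmxE h.
Qed.

Lemma annmul_mul k (V : 'M_(k, n)) k' (W : 'M_(k', n)) a :
  gact rM a = 0 -> (W <= V)%MS -> (W *m gact r a <= annmul r V)%MS.
Proof.
move=> a0 WV; apply: submx_trans (submxMr _ WV) _.
by move: a a0; apply/annmul_subP.
Qed.

Lemma annmul_le k (V : 'M_(k, n)) : mxmodule r V -> (annmul r V <= V)%MS.
Proof. by move=> modV; apply/annmul_subP=> a _; apply: mxmodule_mulr. Qed.

Lemma annmulS k (V : 'M_(k, n)) k' (W : 'M_(k', n)) :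
  (V <= W)%MS -> (annmul r V <= annmul r W)%MS.
Proof. by move=> VW; apply/annmul_subP=> a a0; apply: annmul_mul. Qed.

Lemma annmul_module k (V : 'M_(k, n)) : mxmodule r (annmul r V).
Proof.
apply/mxmodule_gact=> b; rewrite sumsmxMr; apply/sumsmx_subP=> a /eqP a0.
apply: submx_trans (_ : (V *m gact r a) *m gact r b <= _)%MS.
  by rewrite submxMr // genmxE.
by rewrite -mulmxA -gactM annmul_mul // gactM a0 mul0mx.
Qed.

Lemma annmulD (U V : 'M_n) : (annmul r (U + V)%MS :=: annmul r U + annmul r V)%MS.
Proof.
apply/eqmxP; rewrite addsmx_sub !annmulS ?addsmxSl ?addsmxSr // !andbT.
apply/annmul_subP=> a a0; rewrite addsmxMr.
by apply: addsmxS; apply: annmul_mul.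
Qed.

End Annmul.

(** For [t] in [V] outside [U], a minimal left ideal [C] has [C.t] not inside [U], so [C.t = V]. An
    element of [U] is then [c.t] with [c] in [C], and such a [c] kills [M]. *)
Lemma unique_max_sub_annmul n (r : mx_representation K [set: gT] n) (V U : 'M_n) :
  mx_irreducible rM -> mxmodule r V -> mxmodule r U -> ~~ (V <= U)%MS ->
  (forall W : 'M_n, mxmodule r W -> (W <= V)%MS -> (W <= U)%MS || (V <= W)%MS) ->
  (U <= V)%MS -> (U <= annmul r V)%MS.
Proof.
move=> irrM modV modU /row_subPn[i tU] maxU UV; set t := row i V in tU.
have tV : (t <= V)%MS by apply: row_sub.
have [C [modC CU Cann]] := minimal_left_ideal irrM modU tU.
have VC : (V <= C *m orb r t)%MS.
  have := maxU <<C *m orb r t>>%MS; rewrite !genmxE (negbTE CU) /=; apply.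
    by rewrite (eqmx_module _ (genmxE _)) orb_mxmodule.
  rewrite mulmx_sub //; apply: orb_sub => a; exact: mxmodule_mulr.
apply/row_subP=> j; have kU := row_sub j U; move: (row j U) kU => k kU.
have /submxP[w ew] := submx_trans (submx_trans kU UV) VC.
rewrite mulmxA -(decK (w *m C)) enc_orb in ew; rewrite ew annmul_mul //.
apply: Cann => [_|]; first by rewrite -ew.
by rewrite decK submxMl.
Qed.

(** Schur's lemma: the image is everything and the kernel is zero. *)
Lemma irr_hom_rsim m2 (r2 : mx_representation K [set: gT] m2) (h : 'M_(m, m2)) :
  mx_irreducible rM -> mx_irreducible r2 -> modhom rM r2 h -> h != 0 ->
  mx_rsim rM r2.
Proof.
move=> irr1 irr2 hom nz.
have full : row_full h.
  apply: (irr_sub_full irr2) nz; apply/mxmoduleP=> g _.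
  by rewrite -hom submxMl.
have free : row_free h.
  rewrite -kermx_eq0; apply: contraTT nz => nzk; rewrite negbK.
  have : row_full (kermx h).
    apply: (irr_sub_full irr1) nzk; apply/mxmoduleP=> g _.
    by apply/sub_kermxP; rewrite -mulmxA hom mulmxA mulmx_ker mul0mx.
  by rewrite -sub1mx sub_kermx mul1mx.
exists h => //; by rewrite -(eqP full) (eqP free).
Qed.

Lemma modhomE m2 (r2 : mx_representation K [set: gT] m2) (h : 'M_(m, m2)) :
  (forall a, gact rM a *m h = h *m gact r2 a) <-> modhom rM r2 h.
Proof.
split=> hom => [g|a]; first by have := hom (gdelta K g^-1%g); rewrite !gact_delta invgK.
rewrite mulmx_suml mulmx_sumr; apply: eq_bigr => g _.
by rewrite -scalemxAl -scalemxAr hom.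
Qed.

End Annihilator.

(** Take a minimal left ideal [C] with [C.t] nonzero. Its elements killing [t] kill [M], so
    [c.t |-> c.s] is a well-defined map, and Schur's lemma applies to it. *)
Lemma irr_ann_rsim m (rM : mx_representation K [set: gT] m)
    n (rT : mx_representation K [set: gT] n) :
  mx_irreducible rM -> mx_irreducible rT ->
  (forall a, gact rM a = 0 -> gact rT a = 0) -> mx_rsim rM rT.
Proof.
move=> irrM irrT annT; apply: mx_rsim_sym.
have /mx_irrP[n0 _] := irrT; pose t : 'rV[K]_n := delta_mx 0 (Ordinal n0).
have t0 : ~~ (t <= (0 : 'M_n))%MS.
  rewrite submx0; apply/eqP=> /rowP/(_ (Ordinal n0)); rewrite !mxE !eqxx.
  by move/eqP; rewrite oner_eq0.
have [C [modC CT Cann]] := minimal_left_ideal irrM (mxmodule0 rT n) t0.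
set T := orb rT t in CT.
have fullT : row_full (C *m T).
  by apply: (irr_sub_full irrT); [exact: orb_mxmodule | rewrite -submx0].
have /row_subPn[i ciT] := CT; rewrite row_mul in ciT.
pose c := dec (row i C); have cC : (enc c <= C)%MS by rewrite decK row_sub.
have : gact rM c != 0.
  apply: contraNneq ciT => /annT c0.
  by rewrite -(decK (row i C)) enc_orb c0 mulmx0 sub0mx.
move=> nzc; have [k nzk] : exists k, row k (gact rM c) != 0.
  apply/existsP; apply: contraR nzc => /existsPn h; apply/eqP/row_matrixP=> k.
  by rewrite row0; apply/eqP; have := h k; rewrite negbK.
pose S := orb rM (delta_mx 0 k).
(* The pseudo-inverse picks one preimage in [C]; the next claim shows that the choice does not
   matter. *)
pose h := pinvmx (C *m T) *m (C *m S).
have CTh (u : 'rV_#|gT|) : (u <= C)%MS -> u *m T *m h = u *m S.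
  move=> uC; have := submxMr T uC; move/mulmxKpV=> e; rewrite /h mulmxA.
  set w := u *m T *m _ in e *.
  have d0 : (u - w *m C) *m T = 0 by rewrite mulmxBl -mulmxA e subrr.
  suff : (u - w *m C) *m S = 0.
    by rewrite mulmxBl -mulmxA => /eqP; rewrite subr_eq0 => /eqP.
  have dC : (u - w *m C <= C)%MS by rewrite addmx_sub ?eqmx_opp ?submxMl.
  rewrite -(decK (u - _)) enc_orb Cann ?mulmx0 ?decK // => _.
  by rewrite -enc_orb decK d0 sub0mx.
clearbody h; apply: (@irr_hom_rsim _ rT _ rM h) => //; last first.
  apply: contraNneq nzk => h0; rewrite rowE -enc_orb -/S -CTh //.
  by rewrite h0 mulmx0.
apply/modhomE=> a; apply: (row_full_inj fullT); apply/row_matrixP=> j.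
rewrite !row_mul !mulmxA; set u := row j C; have uC : (u <= C)%MS by apply: row_sub.
have -> : u *m T *m gact rT a = enc (a * dec u) *m T.
  by rewrite enc_orb gactM mulmxA -(enc_orb _ (dec u)) decK.
rewrite !CTh //; last by rewrite -enc_lreg decK; apply: mxmodule_mulr.
by rewrite enc_orb gactM mulmxA -(enc_orb _ (dec u)) decK.
Qed.

(** * Actions on submodules and quotients *)

Section Quotients.
Variables (n : nat) (r : mx_representation K [set: gT] n) (U : 'M[K]_n).
Hypothesis modU : mxmodule r U.

Lemma val_submod_gact k (W : 'M_(k, \rank U)) a :
  val_submod (W *m gact (submod_repr modU) a) = val_submod W *m gact r a.
Proof.
rewrite mulmx_sumr linear_sum mulmx_sumr; apply: eq_bigr => g _ /=.
by rewrite -scalemxAr linearZ /= val_submodJ ?inE // scalemxAr.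
Qed.

Lemma in_submod_gact k (W : 'M_(k, n)) a : (W <= U)%MS ->
  in_submod U (W *m gact r a) = in_submod U W *m gact (submod_repr modU) a.
Proof.
move=> WU; apply: val_submod_inj; rewrite val_submod_gact !in_submodK //.
exact: mxmodule_mulr.
Qed.

Lemma in_factmod_gact k (W : 'M_(k, n)) a :
  in_factmod U (W *m gact r a) = in_factmod U W *m gact (factmod_repr modU) a.
Proof.
rewrite !mulmx_sumr linear_sum; apply: eq_bigr => g _ /=.
by rewrite -!scalemxAr linearZ /= -in_factmodJ ?inE.
Qed.

Lemma submod_gact_eq0 a : (gact (submod_repr modU) a == 0) = (U *m gact r a == 0).
Proof.
rewrite -(inj_eq (@val_submod_inj _ _ U _)) -[gact _ a]mul1mx val_submod_gact linear0.
by rewrite -!submx0 (eqmxMr _ (val_submod1 U)).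
Qed.

End Quotients.

(** * Simple layers and Nakayama's lemma for a single simple module *)

Section UniqueSimple.
Variables (f : A) (m : nat) (rM : mx_representation K [set: gT] m).
Hypothesis uniqM : forall m' (rM' : mx_representation K [set: gT] m'),
  Bmodule f rM' -> mx_irreducible rM' -> mx_rsim rM rM'.

Lemma rsim_gact_eq0 m1 m2 (r1 : mx_representation K [set: gT] m1)
    (r2 : mx_representation K [set: gT] m2) a :
  mx_rsim r1 r2 -> (gact r1 a == 0) = (gact r2 a == 0).
Proof.
case=> B e; move: r2 B; case: m2 / e => r2 B; rewrite row_free_unit => uB homB.
have hom : gact r1 a *m B = B *m gact r2 a.
  by move: a; apply/modhomE=> g; apply: homB; rewrite inE.
apply/eqP/eqP=> e0; rewrite e0 ?mul0mx ?mulmx0 in hom.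
  by rewrite -[gact _ _](mulKmx uB) -hom mulmx0.
by rewrite -[gact _ _](mulmxK uB) hom mul0mx.
Qed.

(** For [W] minimal among the submodules of [V] strictly above [U], the quotient [W / U] is a simple
    [B]-module, hence a copy of [M], with its dimension and annihilator. *)
Lemma exists_simple_layer n (r : mx_representation K [set: gT] n) (U V : 'M_n) :
  mxmodule r U -> mxmodule r V -> V *m gact r f = V -> (U < V)%MS ->
  exists W : 'M_n, [/\ mxmodule r W, (U < W)%MS, (W <= V)%MS,
    \rank W = (\rank U + m)%N & forall a, (W *m gact r a <= U)%MS = (gact rM a == 0)].
Proof.
move=> modU modV fV ltUV.
pose Q (W : 'M[K]_n) := [&& mxmodule r W, (U < W)%MS & (W <= V)%MS].
have QV : Q V by rewrite /Q modV ltUV submx_refl.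
case: (arg_minnP (fun W : 'M[K]_n => \rank W) QV) => W /and3P[modW ltUW WV] minW.
have sUW := ltmxW ltUW.
have maxUW : max_submod r U W.
  split=> // Y [modY ltUY ltYW]; have := minW Y.
  rewrite /Q modY ltUY (submx_trans (ltmxW ltYW) WV) => /(_ isT).
  by rewrite leqNgt (rank_ltmx ltYW).
have irrS := (max_submodP modU modW sUW).1 maxUW.
set X := <<in_factmod U W>>%MS; set rS := section_repr modU modW in irrS.
have gS a : (gact rS a == 0) = (W *m gact r a <= U)%MS.
  rewrite submod_gact_eq0 -submx0 (eqmxMr _ (genmxE _)) submx0.
  by rewrite -in_factmod_gact in_factmod_eq0.
have BS : Bmodule f rS.
  have fW : W *m gact r f = W.
    have /submxP[w ->] := WV; by rewrite -mulmxA fV.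
  apply/eqP; rewrite -subr_eq0 -(gact1 rS) -gactB gS gactB mulmxBr fW gact1.
  by rewrite mulmx1 subrr sub0mx.
have sim := uniqM BS irrS; exists W; split=> //.
  rewrite (mxrank_rsim sim) genmxE addnC mxrank_in_factmod.
  by rewrite (addsmx_idPr sUW).
by move=> a; rewrite (rsim_gact_eq0 a sim) gS.
Qed.

(** Induction on the codimension of [U] in [V]: for a simple layer [W / U], induction gives [V = W],
    and [J] kills [W / U], so [JV] lies in [U]. *)
Lemma nakayama n (r : mx_representation K [set: gT] n) (U V : 'M_n) :
  mxmodule r U -> mxmodule r V -> V *m gact r f = V -> (U <= V)%MS ->
  (V <= U + annmul rM r V)%MS -> (V <= U)%MS.
Proof.
move: {2}(\rank V - \rank U)%N (leqnn (\rank V - \rank U)) => k.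
elim: k => [|k IH] in U *; move=> le_k modU modV fV UV VUJ.
  by rewrite -(geq_leqif (mxrank_leqif_sup UV)) -subn_eq0 -leqn0.
apply: contraT => nVU; have ltUV : (U < V)%MS by rewrite /ltmx UV.
have [W [modW ltUW WV _ annW]] := exists_simple_layer modU modV fV ltUV.
have VW : (V <= W)%MS.
  apply: IH => //; last by apply: submx_trans VUJ (addsmxS (ltmxW ltUW) _).
  rewrite -ltnS; apply: leq_trans le_k.
  by rewrite ltn_sub2l ?rank_ltmx // (leq_trans (rank_ltmx ltUW)) ?mxrankS.
case/negP: nVU; apply: submx_trans VUJ _; rewrite addsmx_sub submx_refl.
apply/annmul_subP=> a a0; apply: submx_trans (submxMr _ VW) _.
by rewrite annW a0.
Qed.

Lemma nakayama0 n (r : mx_representation K [set: gT] n) (V : 'M_n) :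
  mxmodule r V -> V *m gact r f = V -> (V <= annmul rM r V)%MS -> V = 0.
Proof.
move=> modV fV VJ; apply: submx0null; apply: (nakayama (mxmodule0 r n)) => //.
  exact: sub0mx.
exact: submx_trans VJ (addsmxSr _ _).
Qed.

End UniqueSimple.
End Modules.

(** * Uniserial modules and chains of submodules *)

Section Uniserial.
Variables (K : finFieldType) (gT : finGroupType) (n : nat).
Variable r : mx_representation K [set: gT] n.

(** In a chain every nonzero submodule occurs in every composition series. So two series have the
    same sorted list of ranks, and equal rank in a chain means equality. *)
Lemma chain_uniserial :
  (forall U V : 'M_n, mxmodule r U -> mxmodule r V -> (U <= V)%MS || (V <= U)%MS) ->
  uniserial r.
Proof.
move=> chain; split.
  (* The existence result is only classical; it is instantiated at the boolean reflection of the
     goal. *)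
  have := @mx_Schreier _ _ _ _ r [::] isT isT; move/(_ `[<exists Us, comp_series r Us>]).
  move=> h; apply/asboolP/h => -[Us [compU lastU _]].
  by apply/asboolP; exists Us; split=> //; apply/eqmxP.
have occurs Us (W : 'M_n) : comp_series r Us -> mxmodule r W -> W != 0 ->
    exists2 i, (i < size Us)%N & (nth 0 Us i == W)%MS.
  case=> -[modU maxU] lastU modW nzW.
  have hasW : has (fun U => W <= U)%MS Us.
    case/lastP: Us modU maxU lastU => [|Us U] modU maxU.
      move/eqmxP=> /= e; case/negP: nzW; rewrite -submx0.
      by rewrite e submx1.
    rewrite last_rcons => /eqmxP e; rewrite has_rcons.
    by rewrite (eqmxP (introT eqmxP e)) submx1.
  set i := find (fun U => W <= U)%MS Us; exists i; first by rewrite -has_find.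
  have WU : (W <= nth 0 Us i)%MS by apply: (nth_find 0 hasW).
  have lt_i : (i < size Us)%N by rewrite -has_find.
  have [_ noY] := maxU i lt_i; rewrite WU andbT; apply: contraT => nUW.
  case: (noY W); split=> //; last by rewrite /ltmx WU.
  (* Here [nth 0 (0 :: Us) i] is the term before the [i]-th one, with [0] before the first. *)
  have nWU : ~~ (W <= nth 0 (0 :: Us) i)%MS.
    case e: i => [|j] /=; first by rewrite submx0.
    by have /= := before_find 0 (_ : (j < i)%N); rewrite e => /(_ (ltnSn j)) ->.
  rewrite /ltmx nWU andbT; have := chain _ _ (mx_subseries_module' i modU) modW.
  by rewrite (negbTE nWU) orbF.
have sorted_rank Us : comp_series r Us -> sorted ltn (map (fun U : 'M_n => \rank U) Us).
  case=> /mx_series_lt lt _; case: Us lt => //= U Us /andP[_].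
  rewrite path_map; apply: sub_path => X Y /=; exact: rank_ltmx.
have nz_term Us i : comp_series r Us -> (i < size Us)%N -> nth 0 Us i != 0.
  move=> [[modU maxU] _] lt_i; have [lt0 _] := maxU i lt_i; rewrite -mxrank_eq0 -lt0n.
  exact: leq_ltn_trans (leq0n _) (rank_ltmx lt0).
have sub_rank Us Vs : comp_series r Us -> comp_series r Vs ->
    {subset map (fun U : 'M_n => \rank U) Us <= map (fun U : 'M_n => \rank U) Vs}.
  move=> cU cV q /(nthP 0)[i]; rewrite size_map => lt_i <-.
  rewrite (nth_map 0) //; have [[modU _] _] := cU.
  have [j lt_j /eqmxP e] :=
    occurs Vs _ cV (mx_subseries_module i modU) (nz_term Us i cU lt_i).
  by apply/(nthP 0); exists j; rewrite ?size_map ?(nth_map 0) // e.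
move=> Us Vs cU cV.
have eq_ranks : map (fun U : 'M_n => \rank U) Us = map (fun U : 'M_n => \rank U) Vs.
  apply: (irr_sorted_eq ltn_trans ltnn); rewrite ?sorted_rank //.
  by move=> q; apply/idP/idP; apply: sub_rank.
have eq_size : size Us = size Vs.
  by rewrite -(size_map (fun U : 'M_n => \rank U)) eq_ranks size_map.
split=> // i; have [lt_i|ge_i] := ltnP i (size Us); last first.
  by rewrite !nth_default -?eq_size // !submx_refl.
have eq_rank : \rank (nth 0 Us i) = \rank (nth 0 Vs i).
  by rewrite -!(nth_map 0 0%N (fun U : 'M_n => \rank U)) -?eq_size // eq_ranks.
have [[modU _] _] := cU; have [[modV _] _] := cV.
have := chain _ _ (mx_subseries_module i modU) (mx_subseries_module i modV).
case/orP=> le; rewrite le ?andbT /=.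
  by rewrite -(geq_leqif (mxrank_leqif_sup le)) eq_rank.
by rewrite -(geq_leqif (mxrank_leqif_sup le)) eq_rank.
Qed.

(** Each of [U] and [V] extends to a composition series; by uniqueness both occur in the same
    one. *)
Lemma uniserial_chain : uniserial r ->
  forall U V : 'M_n, mxmodule r U -> mxmodule r V -> (U <= V)%MS || (V <= U)%MS.
Proof.
move=> [_ uniq] U V modU modV.
have [->|nzU] := eqVneq U 0; first by rewrite sub0mx.
have [->|nzV] := eqVneq V 0; first by rewrite sub0mx orbT.
have ext W : mxmodule r W -> W != 0 -> exists2 Ws, comp_series r Ws & W \in Ws.
  move=> modW nzW; have := @mx_Schreier _ _ _ _ r [:: W].
  rewrite /mx_subseries /= modW /ltmx sub0mx submx0 nzW => /(_ isT isT).
  move/(_ `[<exists2 Ws, comp_series r Ws & W \in Ws>]) => h; apply/asboolP/h.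
  move=> [Ws [compW lastW sW]]; apply/asboolP; exists Ws.
    by split=> //; apply/eqmxP.
  by rewrite -sub1seq.
have [Us cU /(nthP 0)[i lt_i <-]] := ext U modU nzU.
have [Vs cV /(nthP 0)[j lt_j <-]] := ext V modV nzV.
have [eq_size eqUV] := uniq _ _ cU cV; rewrite -eq_size in lt_j.
have /eqmxP e := eqUV j; rewrite -!e {e}.
have homo : {in [pred k | (k < size Us)%N] &,
    {homo nth (0 : 'M[K]_n) Us : k l / (k <= l)%N >-> (k <= l)%MS}}.
  apply: sorted_leq_nth.
  - by move=> Y X Z; apply: submx_trans.
  - by move=> X; apply: submx_refl.
  have [/mx_series_lt lt _] := cU; case: Us lt {cU uniq eq_size eqUV lt_i lt_j}.
    by [].
  move=> X Us /= /andP[_].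
  by apply: sub_path => Y Z; apply: ltmxW.
by case/orP: (leq_total i j) => le; apply/orP; [left|right]; apply: homo.
Qed.
End Uniserial.

(** * Blocks in which the annihilator of a simple module is principal *)

Section PrincipalToUniserial.
Variables (K : finFieldType) (gT : finGroupType).
Local Notation A := (kG K gT).
Implicit Types a b c e x : A.

Lemma gact_idem n (r : mx_representation K [set: gT] n) (f : A) k (V : 'M_(k, n)) :
  f * f = f -> (V <= gact r f)%MS -> V *m gact r f = V.
Proof. by move=> ff /submxP[w ->]; rewrite -mulmxA -gactM ff. Qed.

Lemma gact_central_module n (r : mx_representation K [set: gT] n) (f : A) :
  (forall a, f * a = a * f) -> mxmodule r (gact r f).
Proof. by move=> fC; apply/mxmodule_gact=> a; rewrite -gactM -fC gactM submxMl. Qed.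

Lemma submod_Bmodule n (r : mx_representation K [set: gT] n) (f : A) (U : 'M_n)
  (modU : mxmodule r U) : U *m gact r f = U -> Bmodule f (submod_repr modU).
Proof.
move=> fU; apply: val_submod_inj; rewrite -[gact _ f]mul1mx val_submod_gact.
have /submxP[w ->] : (val_submod (1%:M : 'M_(\rank U)) <= U)%MS by apply: val_submodP.
by rewrite -mulmxA fU.
Qed.

Lemma Bmodule_mul n (r : mx_representation K [set: gT] n) (f : A) k (V : 'M_(k, n)) :
  Bmodule f r -> V *m gact r f = V.
Proof. by move=> ->; rewrite mulmx1. Qed.

(** Symmetry and the hypothesis for [c] give [(ebec)(1) = (bece)(1) = (bec)(1)] for every [c], so
    [ebe = be] by nondegeneracy. *)
Lemma two_sided_idem_central e : e * e = e -> (forall b, e * b = e * b * e) ->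
  forall a, e * a = a * e.
Proof.
move=> ee eb b; rewrite eb; apply/eqP; rewrite -subr_eq0; apply/eqP/at1_eq0 => c.
have at1B x y : (x - y) 1%g = x 1%g - y 1%g by rewrite !ffunE.
rewrite mulrBl at1B; apply/eqP; rewrite subr_eq0; apply/eqP.
by rewrite -!mulrA mul_at1C -!mulrA (mulrA e c e) -eb.
Qed.

(** A simple submodule of the block, which is the row space of [gact (lreg K gT) f]. *)
Lemma exists_irr_Bmodule (f : A) : (forall a, f * a = a * f) -> f * f = f -> f != 0 ->
  exists m (rM : mx_representation K [set: gT] m), Bmodule f rM /\ mx_irreducible rM.
Proof.
move=> fC ff f0; have modF := gact_central_module (lreg K gT) fC.
have nzF : gact (lreg K gT) f != 0.
  apply: contraNneq f0 => e0; have := enc_lreg f 1; rewrite mulr1 e0 mulmx0.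
  by move=> e; rewrite -[f]encK -e -(enc0 K gT) encK.
have := mxsimple_exists modF nzF.
move/(_ `[<exists2 V, mxsimple (lreg K gT) V & (V <= gact (lreg K gT) f)%MS>]) => h.
have /asboolP[V simV VF] : `[<exists2 V, mxsimple (lreg K gT) V & (V <= gact (lreg K gT) f)%MS>].
  by apply: h => h; apply/asboolP.
have [modV _ _] := simV; exists (\rank V), (submod_repr modV); split.
  exact/submod_Bmodule/gact_idem.
exact/submod_mx_irr.
Qed.

Section Radical.
Variables (f x : A) (m : nat) (rM : mx_representation K [set: gT] m).
Hypotheses (BM : Bmodule f rM) (irrM : mx_irreducible rM).
Hypothesis xM : gact rM x = 0.
Hypothesis fx : f * x = x.
Hypothesis annE : forall a, gact rM a = 0 -> exists b, f * a = b * x.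

(** The element [xb] kills [M], so it is a left multiple of [x]. *)
Lemma radical_swap b : exists c, x * b = c * x.
Proof.
have /annE[c e] : gact rM (x * b) = 0 by rewrite gactM xM mulmx0.
by exists c; rewrite -e mulrA fx.
Qed.

Lemma radical_swapX k b : exists c, x ^+ k * b = c * x ^+ k.
Proof.
elim: k b => [|k IH] b; first by exists b; rewrite expr0 mul1r mulr1.
have [c e] := IH b; have [d e'] := radical_swap c.
by exists d; rewrite exprS -mulrA e mulrA e' mulrA.
Qed.

Lemma radical_nilpotent :
  (forall e, (forall a, e * a = a * e) -> e * e = e -> f * e = e -> e = 0 \/ e = f) ->
  exists2 k, (0 < k)%N & x ^+ k = 0.
Proof.
move=> prim; have [k k0 ee] := idem_power x (@inj_id A).
exists k => //; have /mx_irrP[m0 _] := irrM.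
have [||//|ef] := prim (x ^+ k) _ ee.
- apply: two_sided_idem_central => // b; have [c e] := radical_swapX k b.
  by rewrite e -mulrA ee.
- by rewrite -(prednK k0) exprS mulrA fx.
(* If the idempotent power were [f], the identity of [B] would kill [M]. *)
have : gact rM f = 0 by rewrite -ef -(prednK k0) exprS gactM xM mulmx0.
move: BM; rewrite /Bmodule => -> /(congr1 mxrank); rewrite mxrank1 mxrank0 => e.
by rewrite e in m0.
Qed.

(** The kernel of [x] on a simple [T] is a submodule, nonzero as [x] is nilpotent. So [x] kills [T],
    hence so does the annihilator of [M]. *)
Lemma radical_unique_simple k : x ^+ k = 0 ->
  forall n (rT : mx_representation K [set: gT] n),
  Bmodule f rT -> mx_irreducible rT -> mx_rsim rM rT.
Proof.
move=> xk n rT BT irrT; have /mx_irrP[n0 _] := irrT.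
have modK : mxmodule rT (kermx (gact rT x)).
  apply/mxmodule_rV=> b v; rewrite !sub_kermx => /eqP e0; rewrite -mulmxA -gactM.
  by have [c ->] := radical_swap b; rewrite gactM mulmxA e0 mul0mx.
have xT : gact rT x = 0.
  apply/eqP; have [k0|nzk] := eqVneq (kermx (gact rT x)) 0.
    have free : row_free (gact rT x) by rewrite -kermx_eq0 k0.
    have rk j : \rank (gact rT (x ^+ j)) = n.
      elim: j => [|j IH]; first by rewrite expr0 gact1 mxrank1.
      by rewrite exprS gactM mxrankMfree.
    by have := rk k; rewrite xk gact0 mxrank0 => e; rewrite -e in n0.
  have := irr_sub_full irrT modK nzk; rewrite -sub1mx sub_kermx mul1mx //.
apply: irr_ann_rsim => // a /annE[b e].
by rewrite -[gact rT a](Bmodule_mul _ BT) -gactM e gactM xT mul0mx.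
Qed.

(* Left and right multiplication by [x] have the same rank, so [Bx] being
   two-sided forces [xB = Bx]. *)
Lemma radical_right_principal a : gact rM a = 0 -> exists b, f * a = x * b.
Proof.
move=> /annE[c e].
(* The row spaces compared are [xA] on the left and [Ax] on the right. *)
have sub : (gact (lreg K gT) x <= orb (lreg K gT) (enc x))%MS.
  apply/row_subP=> i; rewrite rowE -(decK (delta_mx 0 i)) enc_lreg.
  by have [d ->] := radical_swap (dec (delta_mx 0 i)); rewrite -enc_rmul submxMl.
have : (enc (f * a)%R <= gact (lreg K gT) x)%MS.
  rewrite e -enc_rmul; apply: submx_trans (submxMl _ _) _.
  by rewrite -(geq_leqif (mxrank_leqif_sup sub)) rank_rmul.
case/submxP=> w ew; exists (dec w).
by apply: (can_inj (@encK K gT)); rewrite ew -enc_lreg decK.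
Qed.

End Radical.
End PrincipalToUniserial.

(** * Projective covers when the annihilator is [xB] *)

Section ProjectiveCover.
Variables (K : finFieldType) (gT : finGroupType).
Local Notation A := (kG K gT).
Implicit Types a b c e x : A.

(* Lifting [h] through [U] gives an endomorphism with image in [U]; its
   idempotent power splits off a summand, which is everything. *)
Lemma proj_indec_unique_max (f : A) n (r : mx_representation K [set: gT] n)
    m (rM : mx_representation K [set: gT] m) (h : 'M_(n, m)) :
  Bmodule f r -> Bprojective f r -> indecomposable r ->
  Bmodule f rM -> mx_irreducible rM -> modhom r rM h -> row_full h ->
  forall U : 'M_n, mxmodule r U -> (U <= kermx h)%MS || (1%:M <= U)%MS.
Proof.
move=> Br proj [_ indec] BM irrM hom full U modU; apply/orP.
have /mx_irrP[m0 _] := irrM.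
have [Uh|nUh] := boolP (U <= kermx h)%MS; [by left | right].
have Uf : U *m gact r f = U by apply: Bmodule_mul.
pose r1 := submod_repr modU; pose v1 : 'M_(\rank U, n) := val_submod 1%:M.
have hom1 : modhom r1 r v1.
  by move=> g; rewrite -val_submodE -val_submodJ ?inE // mul1mx.
have homp : modhom r1 rM (v1 *m h).
  by move=> g; rewrite mulmxA hom1 -[RHS]mulmxA -hom mulmxA.
have fullp : row_full (v1 *m h).
  apply: (irr_sub_full irrM); first by apply/mxmoduleP=> g _; rewrite -homp submxMl.
  apply: contra nUh => /eqP e; rewrite sub_kermx -submx0.
  by rewrite -(eqmxMr h (val_submod1 U)) -/v1 e sub0mx.
have [psi [hompsi psiE]] := proj _ _ r1 rM _ h (submod_Bmodule modU Uf) BM homp fullp hom.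
pose phi := psi *m v1.
have phiU : (phi <= U)%MS by rewrite mulmx_sub // /v1 val_submod1.
have phih : phi *m h = h by rewrite -mulmxA.
have homphi : modhom r r phi.
  by move=> g; rewrite mulmxA hompsi -[LHS]mulmxA hom1 mulmxA.
have [k k0 id_th] := idem_power (phi : 'M[K]_n) (@inj_id 'M[K]_n).
set th := phi ^+ k in id_th.
have homX j : modhom r r (phi ^+ j).
  elim: j => [|j IH] g; first by rewrite expr0 mulmx1 mul1mx.
  by rewrite exprS mulmxA homphi -mulmxA IH mulmxA.
have Xh j : phi ^+ j *m h = h.
  by elim: j => [|j IH]; rewrite ?expr0 ?mul1mx // exprS -mulmxA IH.
have mod_th : mxmodule r th.
  by apply/mxmoduleP=> g _; rewrite -homX submxMl.
have mod_th' : mxmodule r (1%:M - th).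
  apply/mxmoduleP=> g _; rewrite mulmxBl mul1mx -homX -{1}[r g]mulmx1 -mulmxBr.
  exact: submxMl.
have dx : mxdirect (th + (1%:M - th)).
  apply/mxdirect_addsP/eqP; rewrite -submx0; apply/rV_subP=> v.
  rewrite sub_capmx => /andP[/submxP[u ->] /submxP[w e]].
  have : u *m th *m th = 0.
    by rewrite e -mulmxA mulmxBl mul1mx [th *m th]id_th subrr mulmx0.
  by rewrite -mulmxA [th *m th]id_th => ->; apply: sub0mx.
have tot : (th + (1%:M - th) == 1%:M)%MS.
  by rewrite submx1 /= -{1}[1%:M](subrK th) addrC addmx_sub_adds.
(* The idempotent is nonzero because it fixes [h]; so it is the identity, and its image lies in
   [U]. *)
case/orP: (indec _ _ mod_th mod_th' dx tot) => /eqP e0.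
  have := Xh k; rewrite -/th e0 mul0mx => h0; move: full.
  by rewrite -h0 /row_full mxrank0 => /eqP e; rewrite -e in m0.
move/eqP: e0; rewrite subr_eq0 => /eqP ->.
by rewrite /th -(prednK k0) exprSr (submx_trans (submxMl _ _)).
Qed.

Section RightPrincipalRadical.
Variables (f x : A) (m : nat) (rM : mx_representation K [set: gT] m).
Hypothesis fC : forall a, f * a = a * f.
Hypothesis xM : gact rM x = 0.
Hypothesis annE : forall a, gact rM a = 0 -> exists b, f * a = x * b.

(** If [fa = xb] then [a.u = x.(b.u)] with [b.u] in [U]: this uses a generator of [J] as a right
    ideal. *)
Lemma annmul_gact n (r : mx_representation K [set: gT] n) k (U : 'M_(k, n)) :
  mxmodule r U -> U *m gact r f = U -> (annmul rM r U :=: U *m gact r x)%MS.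
Proof.
move=> modU fU; apply/eqmxP; rewrite annmul_mul // andbT.
apply/annmul_subP=> a /annE[b e]; rewrite -{1}fU -mulmxA -gactM -fC e gactM mulmxA.
by rewrite submxMr // mxmodule_mulr.
Qed.

Hypotheses (BM : Bmodule f rM) (irrM : mx_irreducible rM).
Hypothesis uniqM : forall m' (rM' : mx_representation K [set: gT] m'),
  Bmodule f rM' -> mx_irreducible rM' -> mx_rsim rM rM'.

Lemma proj_cover_uniserial N n (r : mx_representation K [set: gT] n) :
  x ^+ N = 0 -> proj_cover f r rM -> uniserial r.
Proof.
move=> xN [Br projr indec [h hom full]]; apply: chain_uniserial.
set X := gact r x; have fr k (V : 'M_(k, n)) : V *m gact r f = V by apply: Bmodule_mul.
have modX k : mxmodule r (X ^+ k).
  elim: k => [|k IH]; first by rewrite expr0 mxmodule1.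
  rewrite exprSr (eqmx_module _ (eqmx_sym (annmul_gact IH (fr _ _)))).
  exact: annmul_module.
have annX k : (annmul rM r (X ^+ k) :=: X ^+ k.+1)%MS.
  by rewrite exprSr; apply: annmul_gact.
have max_h := proj_indec_unique_max Br projr indec BM irrM hom full.
have mod_h : mxmodule r (kermx h).
  by apply/mxmoduleP=> g _; apply/sub_kermxP; rewrite -mulmxA hom mulmxA mulmx_ker mul0mx.
have /mx_irrP[m0 _] := irrM.
(* The kernel of [x] has the dimension of [P / xP], and [xP] contains the maximal submodule
   [kermx h], of codimension [m]. *)
have rkX : (\rank (kermx X) <= m)%N.
  have kerX : (kermx h <= X)%MS.
    have := annX 0%N; rewrite expr0 expr1 => <-.
    apply: (unique_max_sub_annmul irrM) => //; try exact: mxmodule1; try exact: submx1.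
      rewrite sub_kermx mul1mx; apply: contraTneq full => ->.
      by rewrite /row_full mxrank0 eq_sym -lt0n.
    by move=> W modW _; apply: max_h.
  have := mxrankS kerX; rewrite !mxrank_ker (eqP full) => le.
  by rewrite leq_subLR addnC -leq_subLR.
have powers (W : 'M_n) : mxmodule r W -> exists k, (W == X ^+ k)%MS.
  move=> modW; have [W0|nzW] := eqVneq W 0.
    by exists N; rewrite -gactX xN gact0 W0 !submx_refl.
  have [k Wk nWk] : exists2 k, (W <= X ^+ k)%MS & ~~ (W <= X ^+ k.+1)%MS.
    have nWN : ~~ (W <= X ^+ N)%MS by rewrite -gactX xN gact0 submx0.
    elim: N nWN {xN} => [|j IH] nW; first by rewrite expr0 submx1 in nW.
    by have [WX|/IH] := boolP (W <= X ^+ j)%MS; first by exists j.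
  exists k; rewrite Wk /=.
  have sX : (X ^+ k.+1 <= X ^+ k)%MS by rewrite -annX annmul_le.
  apply: (nakayama uniqM modW (modX k) (fr _ _) Wk).
  rewrite (adds_eqmx (eqmx_refl W) (annX k)).
  have modS := addsmx_module modW (modX k.+1).
  have lt : (X ^+ k.+1 < W + X ^+ k.+1)%MS.
    by rewrite /ltmx addsmxSr addsmx_sub (negbTE nWk).
  (* A layer of dimension [m] fits between [x^(k+1) P] and [W + x^(k+1) P], while
     [x^k P / x^(k+1) P] has the dimension of the kernel of [x] on [x^k P], at most [m]. *)
  have [Y [_ ltY YW rkY _]] := exists_simple_layer uniqM (modX k.+1) modS (fr _ _) lt.
  have le : (W + X ^+ k.+1 <= X ^+ k)%MS by rewrite addsmx_sub Wk.
  rewrite -(geq_leqif (mxrank_leqif_sup le)).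
  apply: leq_trans (mxrankS YW); rewrite rkY exprSr.
  rewrite -(mxrank_mul_ker (X ^+ k) X) leq_add2l.
  by apply: leq_trans rkX; rewrite mxrankS ?capmxSr.
have decr j k : (j <= k)%N -> (X ^+ k <= X ^+ j)%MS.
  move/subnK <-; elim: (k - j)%N => [|d IH]; first exact: submx_refl.
  by apply: submx_trans IH; rewrite addSn -annX annmul_le.
move=> U V /powers[i /eqmxP eU] /powers[j /eqmxP eV]; rewrite !eU !eV.
by case/orP: (leq_total i j) => /decr ->; rewrite ?orbT.
Qed.

End RightPrincipalRadical.

Lemma principal_uniserial (f : A) : block_idem f ->
  (forall I, left_ideal f I -> principal_left f I) ->
  exists m (rM : mx_representation K [set: gT] m),
    [/\ Bmodule f rM, mx_irreducible rM,
      (forall m' (rM' : mx_representation K [set: gT] m'),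
         Bmodule f rM' -> mx_irreducible rM' -> mx_rsim rM rM') &
      (forall n (rP : mx_representation K [set: gT] n),
         proj_cover f rP rM -> uniserial rP)].
Proof.
move=> [[fC ff] f0 primf] prin.
have {}fC a : f * a = a * f by apply: fC.
have {}ff : f * f = f by apply: ff.
(* Apply the indecomposability of [f] to [f = e + (f - e)]. *)
have prim e : (forall a, e * a = a * e) -> e * e = e -> f * e = e -> e = 0 \/ e = f.
  move=> eC ee fe; case: (primf e (f - e)) => [||||h|h]; [by []| | | |by left|right].
  - split=> [a|]; rewrite !gmulE; first by rewrite mulrBl mulrBr fC eC.
    by rewrite mulrBl !mulrBr ff (eC f) fe ee subrr subr0.
  - by rewrite addrC subrK.
  - by rewrite gmulE mulrBr ee -fC fe subrr.
  by apply/eqP; rewrite eq_sym -subr_eq0; apply/eqP.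
have [m [rM [BM irrM]]] := exists_irr_Bmodule fC ff f0.
exists m, rM.
pose I a := f * a = a /\ gact rM a = 0.
have LI : left_ideal f I.
  split; first split.
  - by move=> a [fa _]; apply/(inBlockP ff).
  - by split; rewrite ?mulr0 // gact0.
  - by move=> a b [fa a0] [fb b0]; split; rewrite ?mulrBr ?fa ?fb // gactB a0 b0 subrr.
  move=> a b [fa a0] /(inBlockP ff) fb; rewrite gmulE.
  by split; rewrite ?mulrA ?fb // gactM a0 mul0mx.
have [x [/(inBlockP ff) fx Ix]] : exists x : A, inBlock f x /\
    forall a, I a <-> exists2 b : A, inBlock f b & a = b * x.
  by have [x] := prin I LI; exists x.
have [_ xM] : I x by apply/Ix; exists f; rewrite ?fx //; apply/(inBlockP ff).
have annE a : gact rM a = 0 -> exists b, f * a = b * x.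
  move=> a0; have : I (f * a) by split; rewrite ?mulrA ?ff // gactM a0 mul0mx.
  by case/Ix=> b _; exists b.
have annE' := radical_right_principal xM fx annE.
have [k k0 xk] := radical_nilpotent BM irrM xM fx annE prim.
have uniqM := radical_unique_simple irrM xM fx annE xk.
split=> // n rP; exact: (proj_cover_uniserial fC xM annE' BM irrM uniqM xk).
Qed.

End ProjectiveCover.

(** * Left ideals generated by idempotents *)

Section UniserialToPrincipal.
Variables (K : finFieldType) (gT : finGroupType).
Local Notation A := (kG K gT).
Local Notation L := (lreg K gT).
Implicit Types a b c e x : A.

Lemma orb_hom n (r : mx_representation K [set: gT] n) v a :
  gact L a *m orb r v = orb r v *m gact r a.
Proof.
apply/row_matrixP=> i; rewrite !row_mul !rowE -(decK (delta_mx 0 i)) enc_lreg.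
by rewrite !enc_orb gactM mulmxA.
Qed.

Lemma submod_orb_hom n (r : mx_representation K [set: gT] n) v
    (U : 'M_#|gT|) (modU : mxmodule L U) :
  modhom (submod_repr modU) r (val_submod 1%:M *m orb r v).
Proof.
apply/modhomE=> a; rewrite mulmxA -val_submodE -[gact _ a]mul1mx val_submod_gact.
by rewrite -!mulmxA orb_hom.
Qed.

(** Lift the image of [e] to [v1] and send [u] to [u.v1]; since [u = ue] on the left ideal, this
    lifts [phi]. *)
Lemma idem_projective (f : A) e (modU : mxmodule L (orb L (enc e))) :
  e * e = e -> Bprojective f (submod_repr modU).
Proof.
set U := orb L (enc e) in modU *; set rP := submod_repr modU.
move=> ee m1 m2 r1 r2 pi phi _ _ hom_pi full_pi hom_phi.
pose v2 := in_submod U (enc e) *m phi; pose v1 := v2 *m pinvmx pi.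
have v1E : v1 *m pi = v2 by apply/mulmxKpV/submx_full.
have eU : (enc e <= U)%MS by apply/orbP; exists 1; rewrite gact1 mulmx1.
exists (val_submod 1%:M *m orb r1 v1); split; first exact: submod_orb_hom.
apply/row_matrixP=> i; rewrite -[_ *m pi]mulmxA row_mul.
set u : 'rV_#|gT| := row i _.
have uE : in_submod U u = row i 1%:M.
  by rewrite /u in_submodE -row_mul -in_submodE val_submodK.
have uU : (u <= U)%MS by apply: submx_trans (row_sub _ _) (val_submodP _).
have ue : dec u * e = dec u.
  have /orbP[b] := uU; rewrite enc_lreg => ->.
  by rewrite encK -mulrA ee.
have hom1 a : gact r1 a *m pi = pi *m gact r2 a by apply: (modhomE _ _ _).2.
have hom2 a : gact rP a *m phi = phi *m gact r2 a by apply: (modhomE _ _ _).2.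
rewrite mulmxA -(decK u) enc_orb -mulmxA hom1 mulmxA v1E /v2 -mulmxA -hom2 mulmxA.
by rewrite -in_submod_gact // enc_lreg ue decK uE -row_mul mul1mx.
Qed.

(** * From a uniserial projective cover to principal left ideals *)

Section UniserialCover.
Variables (f : A) (m : nat) (rM : mx_representation K [set: gT] m).
Hypothesis ff : f * f = f.
Hypothesis fC : forall a, f * a = a * f.
Hypothesis irrM : mx_irreducible rM.
Hypothesis uniqM : forall m' (rM' : mx_representation K [set: gT] m'),
  Bmodule f rM' -> mx_irreducible rM' -> mx_rsim rM rM'.
Local Notation J := (annmul rM L).

Lemma annmul_fixed k (V : 'M_(k, #|gT|)) :
  V *m gact L f = V -> J V *m gact L f = J V.
Proof.
move=> fV; apply: gact_idem => //; apply/annmul_subP=> a _.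
by rewrite -fV -mulmxA -gactM -fC gactM mulmxA submxMl.
Qed.

Lemma ex_gact_row a : gact rM a != 0 -> exists s : 'rV_m, s *m gact rM a != 0.
Proof.
move=> nz; have [i nzi] : exists i, row i (gact rM a) != 0.
  apply/existsP; apply: contraR nz => /existsPn h; apply/eqP/row_matrixP=> i.
  by rewrite row0; apply/eqP; have := h i; rewrite negbK.
by exists (delta_mx 0 i); rewrite -rowE.
Qed.

Lemma annmul_proper (V : 'M_#|gT|) : mxmodule L V -> V *m gact L f = V -> V != 0 ->
  (J V < V)%MS.
Proof.
move=> modV fV nzV; rewrite /ltmx annmul_le //=; apply: contra nzV => VJ.
by rewrite (nakayama0 uniqM modV fV VJ).
Qed.

Lemma annmul_rank (V : 'M_#|gT|) : mxmodule L V -> V *m gact L f = V -> V != 0 ->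
  (\rank (J V) + m <= \rank V)%N.
Proof.
move=> modV fV nzV.
have [W [_ _ WV <- _]] :=
  exists_simple_layer uniqM (annmul_module _ _ V) modV fV (annmul_proper modV fV nzV).
exact: mxrankS.
Qed.

(** A proper submodule [U] of largest rank is the only maximal one, so [U] lies in [JV], and the
    simple layer above [U] is [V / U]. *)
Lemma chain_annmul_rank (V : 'M_#|gT|) : mxmodule L V -> V *m gact L f = V -> V != 0 ->
  (forall U W : 'M_#|gT|, mxmodule L U -> mxmodule L W -> (U <= V)%MS -> (W <= V)%MS ->
    (U <= W)%MS || (W <= U)%MS) ->
  (\rank V <= \rank (J V) + m)%N.
Proof.
move=> modV fV nzV chain.
pose Q (W : 'M[K]_#|gT|) := mxmodule L W && (W < V)%MS.
have Q0 : Q 0 by rewrite /Q mxmodule0 /ltmx sub0mx submx0.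
case: (arg_maxnP (fun W : 'M[K]_#|gT| => \rank W) Q0) => U /andP[modU ltUV] maxU.
have sUV := ltmxW ltUV.
have eqV (W : 'M_#|gT|) : mxmodule L W -> (U < W)%MS -> (W <= V)%MS -> (V <= W)%MS.
  move=> modW ltUW WV; apply: contraT => nVW; have := maxU W.
  rewrite /Q modW /ltmx WV nVW => /(_ isT) /=; by rewrite leqNgt (rank_ltmx ltUW).
have UJ : (U <= J V)%MS.
  apply: (unique_max_sub_annmul irrM) => //; first by case/andP: ltUV.
  move=> W modW WV; case: (boolP (W <= U)%MS) => //= nWU; apply: eqV => //.
  by rewrite /ltmx nWU andbT; have := chain U W modU modW sUV WV; rewrite (negbTE nWU) orbF.
have [W [modW ltUW WV rkW _]] := exists_simple_layer uniqM modU modV fV ltUV.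
apply: leq_trans (mxrankS (eqV W modW ltUW WV)) _.
by rewrite rkW leq_add2r mxrankS.
Qed.

(** Write [e = u + v] along the sum. For [y] in [Y1], [y = ye = yu + yv] puts [y - yu = yv] in both
    summands, so [y = yu]. *)
Lemma idem_split e (Y1 Y2 : 'M_#|gT|) : e * e = e -> f * e = e ->
  mxmodule L Y1 -> mxmodule L Y2 -> (Y1 :&: Y2 = 0)%MS ->
  (Y1 + Y2 :=: orb L (enc e))%MS ->
  exists u : A, [/\ u * u = u, f * u = u & (Y1 :=: orb L (enc u))%MS].
Proof.
move=> ee fe mod1 mod2 dx sumY.
have eU : (enc e <= orb L (enc e))%MS by apply/orbP; exists 1; rewrite gact1 mulmx1.
have Ue y : (enc y <= orb L (enc e))%MS -> y * e = y.
  case/orbP=> b; rewrite enc_lreg => /(can_inj (@encK K gT)) ->.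
  by rewrite -mulrA ee.
have := eU; rewrite -sumY => /sub_addsmxP[[w1 w2] /= ew].
pose u := dec (w1 *m Y1); pose v := dec (w2 *m Y2).
have uY : (enc u <= Y1)%MS by rewrite decK submxMl.
have vY : (enc v <= Y2)%MS by rewrite decK submxMl.
have euv : e = u + v.
  by apply: (can_inj (@encK K gT)); rewrite encD !decK.
have YU : (Y1 <= orb L (enc e))%MS by rewrite -sumY addsmxSl.
have key y : (enc y <= Y1)%MS -> y = y * u.
  move=> yY; have ye : y * e = y by apply: Ue; apply: submx_trans yY YU.
  apply/eqP; rewrite -subr_eq0; apply/eqP/(can_inj (@encK K gT)); rewrite enc0.
  suff : (enc (y - y * u)%R <= Y1 :&: Y2)%MS by rewrite dx => /submx0null.
  rewrite sub_capmx; apply/andP; split.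
    by rewrite encB addmx_sub ?eqmx_opp // -enc_lreg mxmodule_mulr.
  by rewrite -{1}ye euv mulrDr addrC addrA addNr add0r -enc_lreg mxmodule_mulr.
have uu : u * u = u by rewrite -key.
exists u; split=> //.
  have ue : u * e = u by apply: Ue; apply: submx_trans uY YU.
  by rewrite -ue fC -mulrA -fC fe.
apply/eqmxP; apply/andP; split; last first.
  by apply: orb_sub => a; apply: mxmodule_mulr.
apply/rV_subP=> w wY; have /key e' : (enc (dec w) <= Y1)%MS by rewrite decK.
by rewrite -(decK w) e' -enc_rmul submxMl.
Qed.

Hypothesis uniP : forall n (rP : mx_representation K [set: gT] n),
  proj_cover f rP rM -> uniserial rP.

(** Without subtraction, this is [dim (JU / J^2 U) <= dim (U / JU)] for [U = Ae]. If [U] is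
    indecomposable it is a cover of [M], and [m] separates the two sides; otherwise [e] splits and
    the inequalities add up. *)
Lemma idem_rank_layers e : e * e = e -> f * e = e ->
  (\rank (J (orb L (enc e))) + \rank (J (orb L (enc e)))
     <= \rank (orb L (enc e)) + \rank (J (J (orb L (enc e)))))%N.
Proof.
move: {2}(\rank (orb L (enc e))) (leqnn (\rank (orb L (enc e)))) => k.
elim: k => [|k IH] in e *; move=> le_k ee fe; set U := orb L (enc e) in le_k *.
  have J0 : \rank (J U) = 0%N.
    by apply/eqP; rewrite -leqn0 (leq_trans (mxrankS (annmul_le _ (orb_module _ _)))).
  by rewrite J0.
have modU : mxmodule L U by apply: orb_module.
have eU : (enc e <= U)%MS by apply/orbP; exists 1; rewrite gact1 mulmx1.
have fU : U *m gact L f = U.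
  apply/row_matrixP=> i; rewrite row_mul rowE -(decK (delta_mx 0 i)) enc_rmul.
  by rewrite enc_lreg mulrA fC -mulrA fe.
have [U0|nzU] := eqVneq U 0.
  apply: leq_trans (leq_addr _ _); rewrite {2}U0.
  have : (J U <= U)%MS by apply: annmul_le.
  by rewrite U0 => /submx0null ->; rewrite mxrank0.
pose rP := submod_repr modU.
have modJ (V : 'M_#|gT|) : mxmodule L (J V) by apply: annmul_module.
have [indec|ndec] := pselect (indecomposable rP).
  have /uniP/uniserial_chain chain : proj_cover f rP rM.
    split=> //; [exact: submod_Bmodule | exact: idem_projective |].
    (* If [e] killed [M], then [U = JU] and Nakayama's lemma would give [U = 0]. *)
    have nze : gact rM e != 0.
      apply: contra nzU => /eqP e0; rewrite (nakayama0 uniqM modU fU) //.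
      apply: orb_sub => a; rewrite mxmodule_mulr // -[in enc e]ee -enc_lreg.
      exact: annmul_mul.
    have [s nzs] := ex_gact_row nze.
    exists (val_submod 1%:M *m orb rM s); first exact: submod_orb_hom.
    apply: (irr_sub_full irrM).
      apply/mxmoduleP=> g _; rewrite -(submod_orb_hom rM s modU g).
      exact: submxMl.
    apply: contra nzs => /eqP h0; rewrite -enc_orb -(in_submodK eU).
    by rewrite val_submodE -mulmxA h0 mulmx0.
  have [->|nzJ] := eqVneq (J U) 0; first by rewrite mxrank0.
  have JU : (J U <= U)%MS by apply: annmul_le.
  have fJ := annmul_fixed fU.
  have le1 := annmul_rank modU fU nzU.
  have le2 : (\rank (J U) <= \rank (J (J U)) + m)%N.
    apply: chain_annmul_rank => // Y Z modY modZ YJ ZJ.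
    have YU := submx_trans YJ JU; have ZU := submx_trans ZJ JU.
    have := chain <<in_submod U Y>>%MS <<in_submod U Z>>%MS.
    rewrite !(eqmx_module _ (genmxE _)) !genmxE !in_submod_module // => /(_ modY modZ).
    by rewrite -!val_submodS !in_submodK.
  by lia.
have [W1 [W2 [[mod1 mod2 dx tot] nz1 nz2]]] : exists W1 W2 : 'M_(\rank U),
    [/\ [/\ mxmodule rP W1, mxmodule rP W2, mxdirect (W1 + W2) &
      (W1 + W2 == 1%:M)%MS], W1 != 0 & W2 != 0].
  apply: contrapT => no; apply: ndec; split; first by rewrite lt0n mxrank_eq0.
  move=> W1 W2 mod1 mod2 dx tot; apply: contraT; rewrite negb_or => /andP[nz1 nz2].
  by case: no; exists W1, W2.
pose Y1 := <<val_submod W1>>%MS; pose Y2 := <<val_submod W2>>%MS.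
have modY1 : mxmodule L Y1 by rewrite (eqmx_module _ (genmxE _)) (val_submod_module modU).
have modY2 : mxmodule L Y2 by rewrite (eqmx_module _ (genmxE _)) (val_submod_module modU).
have dxY : (Y1 :&: Y2 = 0)%MS.
  apply/eqP; rewrite -submx0; apply/rV_subP => w.
  rewrite sub_capmx !genmxE => /andP[w1 w2].
  have wU : (w <= U)%MS by apply: submx_trans w1 (val_submodP _).
  rewrite -(in_submodK wU) !val_submodS in w1 w2.
  have : (in_submod U w <= W1 :&: W2)%MS by rewrite sub_capmx w1.
  rewrite (mxdirect_addsP dx) => /submx0null w0.
  by rewrite -(in_submodK wU) w0 linear0 sub0mx.
have sumY : (Y1 + Y2 :=: U)%MS.
  apply: eqmx_trans (adds_eqmx (genmxE _) (genmxE _)) _.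
  apply: eqmx_trans (eqmx_sym (addsmxMr _ _ _)) _.
  by apply: eqmx_trans (eqmxMr _ (eqmxP tot)) (val_submod1 U).
have [u [uu fu eY1]] := idem_split ee fe modY1 modY2 dxY sumY.
have dxY' : (Y2 :&: Y1 = 0)%MS by rewrite capmxC.
have sumY' : (Y2 + Y1 :=: U)%MS by rewrite addsmxC.
have [v [vv fv eY2]] := idem_split ee fe modY2 modY1 dxY' sumY'.
have annJ (Y Z : 'M_#|gT|) : (Y :=: Z)%MS -> (J Y :=: J Z)%MS.
  by move=> e'; apply/eqmxP; rewrite !annmulS ?e'.
have rkD (Z1 Z2 Z : 'M_#|gT|) : (Z1 <= Y1)%MS -> (Z2 <= Y2)%MS -> (Z :=: Z1 + Z2)%MS ->
    \rank Z = (\rank Z1 + \rank Z2)%N.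
  move=> s1 s2 ->; rewrite mxrank_disjoint_sum //.
  by have := capmxS s1 s2; rewrite dxY => /submx0null.
have rU : \rank U = (\rank Y1 + \rank Y2)%N by apply: rkD (eqmx_sym sumY).
have eJ : (J U :=: J Y1 + J Y2)%MS.
  by apply: eqmx_trans (annJ _ _ (eqmx_sym sumY)) (annmulD _ _ _ _).
have eJJ : (J (J U) :=: J (J Y1) + J (J Y2))%MS.
  by apply: eqmx_trans (annJ _ _ eJ) (annmulD _ _ _ _).
have rJ := rkD _ _ _ (annmul_le _ modY1) (annmul_le _ modY2) eJ.
have rJJ := rkD _ _ _ (submx_trans (annmul_le _ (modJ Y1)) (annmul_le _ modY1))
  (submx_trans (annmul_le _ (modJ Y2)) (annmul_le _ modY2)) eJJ.
have p1 : (0 < \rank Y1)%N.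
  by rewrite lt0n mxrank_eq0 (eqmx_eq0 (genmxE _)) val_submod_eq0.
have p2 : (0 < \rank Y2)%N.
  by rewrite lt0n mxrank_eq0 (eqmx_eq0 (genmxE _)) val_submod_eq0.
(* Both summands are nonzero, so each is smaller than [U] and induction applies. *)
have := IH u _ uu fu; have := IH v _ vv fv.
rewrite !(annJ _ _ (annJ _ _ (eqmx_sym eY1))) !(annJ _ _ (annJ _ _ (eqmx_sym eY2))).
rewrite !(annJ _ _ (eqmx_sym eY1)) !(annJ _ _ (eqmx_sym eY2)) -!eY1 -!eY2.
move: le_k p1 p2; rewrite rU rJ rJJ.
move: (\rank Y1) (\rank Y2) (\rank (J Y1)) (\rank (J Y2)).
move: (\rank (J (J Y1))) (\rank (J (J Y2))) => q1 q2 j1 j2 n1 n2; clear; lia.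
Qed.

(* By simplicity some [n] in [N] fixes a nonzero vector [s], and then so does
   its idempotent power. *)
Lemma left_ideal_idempotent (N : 'M_#|gT|) c : mxmodule L N -> (enc c <= N)%MS ->
  gact rM c != 0 -> exists2 e : A, (enc e <= N)%MS & e * e = e /\ gact rM e != 0.
Proof.
move=> modN cN nzc; have [s nzs] := ex_gact_row nzc.
have full : row_full (N *m orb rM s).
  apply: (irr_sub_full irrM); first exact: orb_mxmodule.
  apply: contra nzs => /eqP e0; have /submxP[w ew] := cN.
  by rewrite -enc_orb ew -mulmxA e0 mulmx0.
have /submxP[w ew] := submx_full s full.
pose n := dec (w *m N); have sn : s *m gact rM n = s by rewrite -enc_orb decK -mulmxA.
have [k k0 id_k] := idem_power n (@inj_id A); exists (n ^+ k).
  rewrite -(prednK k0) exprSr -enc_lreg mxmodule_mulr // decK submxMl //.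
split=> //; apply: contra nzs => /eqP e0.
have sX j : s *m gact rM (n ^+ j) = s.
  elim: j => [|j IH]; first by rewrite expr0 gact1 mulmx1.
  by rewrite exprSr gactM mulmxA sn.
by rewrite -(sX k) e0 mulmx0 mul0mx.
Qed.

Local Notation F := (gact L f).

(** The hypothesis is [dim (V / JV) <= dim (B / JB)]. Choose [a] in [V] with [Aa + JV] as large as
    possible; if this is not [V], an exchange by an idempotent enlarges it. Nakayama's lemma then
    removes [JV]. *)
Lemma small_top_cyclic (V : 'M_#|gT|) : mxmodule L V -> V *m F = V ->
  (\rank V + \rank (J F) <= \rank F + \rank (J V))%N ->
  exists2 a : A, (enc a <= V)%MS & (V <= orb L (enc a))%MS.
Proof.
move=> modV fV le.
pose Q (a : A) := (enc a <= V)%MS.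
have Q0 : Q 0 by rewrite /Q enc0 sub0mx.
have modJ : mxmodule L (J V) by apply: annmul_module.
have modF : mxmodule L F by apply: gact_central_module.
have JV : (J V <= V)%MS by apply: annmul_le.
case: (arg_maxnP (fun a : A => \rank (orb L (enc a) + J V)%MS) Q0) => a aV maxa.
exists a => //; have modO b : mxmodule L (orb L (enc b)) by apply: orb_module.
have OV b : (enc b <= V)%MS -> (orb L (enc b) <= V)%MS.
  by move=> bV; apply: orb_sub => c; apply: mxmodule_mulr.
apply: (nakayama uniqM (modO a) modV fV (OV _ aV)).
set W := (orb L (enc a) + J V)%MS.
apply: contraT => nVW; have modW : mxmodule L W by apply: addsmx_module.
have ltWV : (W < V)%MS by rewrite /ltmx nVW andbT addsmx_sub OV.
have [Y [_ _ YV _ annY]] := exists_simple_layer uniqM modW modV fV ltWV.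
pose O := orb L (enc a); pose N := (F :&: kermx (in_factmod (J V) O))%MS.
have inN b : (enc b <= N)%MS = (enc b <= F)%MS && (enc (b * a)%R <= J V)%MS.
  rewrite sub_capmx sub_kermx; congr andb.
  by rewrite /in_factmod /= mulmxA enc_rmul in_factmod_eq0.
have modN : mxmodule L N.
  apply/mxmodule_rV => b w; rewrite -(decK w) enc_lreg !inN => /andP[wF wJ].
  by rewrite -enc_lreg mxmodule_mulr //= -mulrA -enc_lreg mxmodule_mulr.
(* [N] consists of the [b] in [B] with [ba] in [JV], so [B / N] embeds in [W / JV], which is smaller
   than [V / JV]. *)
have ltN : (\rank (J F) < \rank N)%N.
  have := mxrank_mul_ker F (in_factmod (J V) O).
  have : (\rank (F *m in_factmod (J V) O) <= \rank (in_factmod (J V) O))%N.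
    exact: mxrankS (submxMl _ _).
  have := mxrank_in_factmod (J V) O; rewrite addsmxC -/W.
  have := rank_ltmx ltWV; rewrite -/N.
  by lia.
have [i nzi] : exists i, gact rM (dec (row i N)) != 0.
  apply: contrapT => /forallNP no; move: ltN; rewrite ltnNge => /negP; apply.
  apply/mxrankS/row_subP => i; have /negP := no i; rewrite negbK => /eqP i0.
  have iN : (row i N <= F)%MS by apply: submx_trans (row_sub _ _) (capmxSl _ _).
  have := gact_idem ff iN; set w := row i N in i0 iN *.
  rewrite -{1}(decK w) enc_lreg fC -enc_lreg => <-.
  apply: annmul_mul => //; apply/submxP; exists (enc 1).
  by rewrite enc_lreg mulr1.
have rowN : (enc (dec (row i N)) <= N)%MS by rewrite decK row_sub.
have [e eN [ee nze]] := left_ideal_idempotent modN rowN nzi.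
have : ~~ (V *m gact L e <= W)%MS.
  apply: contra nze; rewrite -annY; apply: submx_trans; exact: submxMr.
case/row_subPn => j; rewrite row_mul -(decK (row j V)) enc_lreg.
set l := dec (row j V) => nlW.
have lV : (enc l <= V)%MS by rewrite decK row_sub.
(* The new generator recovers both [el = ea'] and, as [ea] is in [JV], [a = (1 - e)a' + ea]; but
   [el] is not in [W]. *)
pose a' := (1 - e) * a + e * l.
have a'V : (enc a' <= V)%MS.
  by rewrite encD -!enc_lreg addmx_sub // mxmodule_mulr.
have /andP[_ eaJ] : (enc e <= F)%MS && (enc (e * a)%R <= J V)%MS by rewrite -inN.
have ea' : e * a' = e * l by rewrite mulrDr !mulrA mulrBr mulr1 ee subrr mul0r add0r.
pose W' := (orb L (enc a') + J V)%MS.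
have modW' : mxmodule L W' by apply: addsmx_module.
have a'W : (enc a' <= W')%MS.
  by apply: submx_trans (addsmxSl _ _); apply/orbP; exists 1; rewrite gact1 mulmx1.
have aW' : (enc a <= W')%MS.
  have -> : a = (1 - e) * a' + e * a.
    rewrite mulrBl ea' mul1r /a' addrK -mulrDl subrK mul1r //.
  rewrite encD addmx_sub //; first by rewrite -enc_lreg mxmodule_mulr.
  exact: submx_trans eaJ (addsmxSr _ _).
have WW' : (W <= W')%MS.
  rewrite addsmx_sub addsmxSr andbT; apply: orb_sub => b.
  exact: mxmodule_mulr.
have := maxa a' a'V; rewrite /= -/W -/W' (geq_leqif (mxrank_leqif_sup WW')) => W'W.
by case/negP: nlW; apply: submx_trans W'W; rewrite -ea' -enc_lreg mxmodule_mulr.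
Qed.

(** [small_top_cyclic] is used twice: for [JF], which yields the generator [x], then for the given
    ideal, where [J] acts through [x]. *)
Lemma uniserial_principal I : left_ideal f I -> principal_left f I.
Proof.
move=> LI; have modF : mxmodule L F by apply: gact_central_module.
have fF : F *m F = F by apply: gact_idem.
have fJF := annmul_fixed fF.
have eF : (orb L (enc f) :=: F)%MS.
  apply/eqmxP/andP; split; apply/row_subP=> i; rewrite rowE -(decK (delta_mx 0 i)).
    by rewrite enc_rmul -fC -enc_lreg submxMl.
  by rewrite enc_lreg fC -enc_rmul submxMl.
have annJ (Y Z : 'M_#|gT|) : (Y :=: Z)%MS -> (J Y :=: J Z)%MS.
  by move=> e'; apply/eqmxP; rewrite !annmulS ?e'.
have := idem_rank_layers ff ff.
rewrite (annJ _ _ (annJ _ _ eF)) (annJ _ _ eF) eF => layers.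
have [x xJ Jx] := small_top_cyclic (annmul_module _ _ F) fJF layers.
have fx : f * x = x.
  apply: (can_inj (@encK K gT)); rewrite -enc_lreg; have /submxP[w ->] := xJ.
  by rewrite -mulmxA fJF.
have xM : gact rM x = 0.
  apply/row_matrixP=> i; rewrite row0 rowE -enc_orb; apply/sub_kermxP.
  apply: submx_trans xJ _; apply/annmul_subP=> a a0; apply/sub_kermxP.
  by rewrite -mulmxA orb_hom a0 !mulmx0.
have annE a : gact rM a = 0 -> exists b, f * a = b * x.
  move=> a0; have : (enc (f * a)%R <= J F)%MS.
    rewrite fC -enc_lreg annmul_mul // -eF; apply/orbP; exists 1.
    by rewrite gact1 mulmx1.
  move/submx_trans/(_ Jx)/orbP=> [b]; rewrite enc_lreg => /(can_inj (@encK K gT)) e.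
  by exists b.
have annE' := radical_right_principal xM fx annE.
have sI := left_ideal_subspace fC ff LI; have inI y := span_mxP y sI.
set V := span_mx I in inI.
have modV : mxmodule L V.
  apply/mxmodule_rV=> b w; rewrite -(decK w) enc_lreg => /inI Iw.
  by apply/inI; exact: (left_idealM fC ff _ LI Iw).
have fV : V *m F = V.
  apply/row_matrixP=> i; rewrite row_mul -(decK (row i V)) enc_lreg; congr enc.
  have /inI Iw : (enc (dec (row i V)) <= V)%MS by rewrite decK row_sub.
  by have [[/(_ _ Iw) /(inBlockP ff)]] := LI.
have eqJ (Y : 'M_#|gT|) := @annmul_gact _ _ f x m rM fC xM annE' _ L _ Y.
have [a aV Va] : exists2 a : A, (enc a <= V)%MS & (V <= orb L (enc a))%MS.
  apply: small_top_cyclic => //; rewrite (eqJ _ modV fV) (eqJ _ modF fF).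
  have eV := mxrank_mul_ker V (gact L x); have eF' := mxrank_mul_ker F (gact L x).
  (* The codimension of [xV] in [V] is the dimension of the kernel of [x] on [V], at most that of
     its kernel on the whole block. *)
  have : (\rank (V :&: kermx (gact L x)) <= \rank (F :&: kermx (gact L x)))%N.
    apply/mxrankS/capmxS => //; rewrite -fV submxMl //.
  by lia.
have /inI Ia := aV; have [[/(_ _ Ia) aB _ _] _] := LI.
exists a => // y; split=> [/inI yV|[b _ ->]]; last exact: (left_idealM fC ff _ LI Ia).
have /orbP[b] := submx_trans yV Va; rewrite enc_lreg => /(can_inj (@encK K gT)) ->.
exists (f * b); first by apply/(inBlockP ff); rewrite mulrA ff.
by rewrite gmulE fC -mulrA; have /(inBlockP ff) -> := aB.
Qed.

End UniserialCover.
End UniserialToPrincipal.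

Theorem mainTheorem9 (K : finFieldType) (p : nat) (gT : finGroupType)
    (f : {ffun gT -> K}) :
  prime p -> p \in [pchar K] -> block_idem f ->
  [<-> (* (a) every right ideal of B is checkable in B *)
       (forall I, right_ideal f I -> checkable f I);
       (* (b) every left ideal of B is principal *)
       (forall I, left_ideal f I -> principal_left f I);
       (* (c) exactly one irreducible left B-module up to isomorphism, and its
              projective cover is uniserial *)
       (exists m (rM : mx_representation K [set: gT] m),
          [/\ Bmodule f rM, mx_irreducible rM,
              (forall m' (rM' : mx_representation K [set: gT] m'),
                 Bmodule f rM' -> mx_irreducible rM' -> mx_rsim rM rM') &
              (forall n (rP : mx_representation K [set: gT] n),
                 proj_cover f rP rM -> uniserial rP)])].
Proof.
move=> _ _ blk; have [[fC ff] _ _] := blk; tfae.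
- exact: (checkable_principal fC ff).
- exact: principal_uniserial.
(* The cycle is closed by (c) -> (a), obtained through (b). *)
- move=> [m [rM [BM irrM uniqM uniP]]]; apply: (principal_checkable fC ff) => I.
  exact: (uniserial_principal ff fC irrM uniqM uniP).
Qed.
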